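(* Let $C$ and $H$ be two weak Hopf algebras over a field $\Bbbk$ such that $C$ is a (left) $H$-comodule bialgebra via $\rho(c)=c^{-1}\otimes c^{0}$ and $H$ is commutative. For $c\in C$, $h\in H$ put $c\times h=c^{0}\otimes h_2\,\varepsilon_H(c^{-1}h_1)\in C\otimes H$ and let $C\times H\subseteq C\otimes H$ be the linear span of all $c\times h$. Then $C\times H$, with product $(c\times h)(b\times k)=cb\times hk$, unit $1_C\times 1_H$, coproduct $\Delta(c\times h)=c_1\times{c_2}^{-1}h_1\otimes{c_2}^{0}\times h_2$ and counit $\varepsilon(c\times h)=\varepsilon_C(c^{0})\varepsilon_H(c^{-1}h)$, is a weak Hopf algebra.
   Context: All tensor products are over the field $\Bbbk$, all maps are $\Bbbk$-linear, and $V\otimes\Bbbk\simeq V\simeq\Bbbk\otimes V$ is used as an identification; Sweedler notation $\Delta(h)=h_1\otimes h_2$ is used, and $\tau_{V,W}:V\otimes W\to W\otimes V$ is the flip. $I_V$ is the identity map of $V$. Algebras are associative and unital, coalgebras coassociative and counital. The product and coproduct of $C\times H$ in the claim are the restrictions of the product $(c\otimes h)(b\otimes k)=cb\otimes hk$ and coproduct $\Delta(c\otimes h)=c_1\otimes{c_2}^{-1}h_1\otimes{c_2}^{0}\otimes h_2$ of $C\otimes H$. A weak bialgebra $(H,m,u,\Delta,\varepsilon)$ is a vector space that is both an algebra and a coalgebra such that for all $h,k,\ell\in H$: (i) $\Delta(hk)=\Delta(h)\Delta(k)$; (ii) $\varepsilon(hk\ell)=\varepsilon(hk_1)\varepsilon(k_2\ell)=\varepsilon(hk_2)\varepsilon(k_1\ell)$;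 (iii) $(1_H\otimes\Delta(1_H))(\Delta(1_H)\otimes 1_H)=(\Delta(1_H)\otimes 1_H)(1_H\otimes\Delta(1_H))=\Delta^2(1_H)$, where $\Delta^2=(\Delta\otimes I)\Delta$. With $\Delta(1_H)=1_1\otimes 1_2$, define $\varepsilon_t(h)=\varepsilon(1_1h)1_2$, $\varepsilon_s(h)=1_1\varepsilon(h1_2)$, $H_t=\varepsilon_t(H)$, $H_s=\varepsilon_s(H)$. A weak Hopf algebra is a weak bialgebra with a linear map $S:H\to H$ (antipode) such that $h_1S(h_2)=\varepsilon_t(h)$, $S(h_1)h_2=\varepsilon_s(h)$, $S(h_1)h_2S(h_3)=S(h)$ for all $h\in H$. A coalgebra $C$ is a (left) $H$-comodule coalgebra via a linear map $\rho:C\to H\otimes C$ if for all $c\in C$: (CC1) $(\varepsilon_H\otimes I_C)\rho(c)=c$; (CC2) $(I_H\otimes\Delta_C)\rho(c)=(m_H\otimes I_C\otimes I_C)(I_H\otimes\tau_{C,H}\otimes I_C)(\rho\otimes\rho)\Delta_C(c)$; (CC3) $(I_H\otimes\rho)\rho(c)=(\Delta_H\otimes I_C)\rho(c)$; (CC4) $(I_H\otimes\varepsilon_C)\rho(c)=(\varepsilon_t\otimes\varepsilon_C)\rho(c)$. An algebra $C$ is a (left) $H$-comodule algebra via $\rho:C\to H\otimes C$ if (CC1) and (CC3) hold, $\rho(cd)=\rho(c)\rho(d)$ for all $c,d\in C$, and $\rho(1_C)\in H_s\otimes C$ (i.e. $\rho(1_C)=(\varepsilon_s\otimes I_C)\rho(1_C)$).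 A weak bialgebra $C$ is a (left) $H$-comodule bialgebra if one linear map $\rho:C\to H\otimes C$ makes it simultaneously a (left) $H$-comodule coalgebra and a (left) $H$-comodule algebra. *)

(* Defs.v *)
From HB Require Import structures.
From mathcomp Require Import all_boot all_algebra.
From mathcomp Require Import boolp freeg.

Set Implicit Arguments.
Unset Strict Implicit.
Unset Printing Implicit Defensive.

Import GRing.Theory.
Import Quotient.
Local Open Scope ring_scope.
Local Open Scope quotient_scope.

Section Span.
Variables (k : fieldType) (V : lmodType k) (S : V -> Prop).

Definition span : {pred V} := fun x =>
  `[< exists n (a : 'I_n -> k) (v : 'I_n -> V),
        (forall i, S (v i)) /\ x = \sum_(i < n) a i *: v i >].

Lemma mem_span x : S x -> x \in span.
Proof.
move=> Sx; apply/asboolP; exists 1%N, (fun=> 1), (fun=> x).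
by split=> //; rewrite big_ord1 scale1r.
Qed.

Lemma span_submod : submod_closed span.
Proof.
split; first by apply/asboolP; exists 0%N, (fun=> 0), (fun=> 0); split;
  [case | rewrite big_ord0].
move=> c x y /asboolP[n [a [v [Sv ->]]]] /asboolP[m [b [w [Sw ->]]]].
apply/asboolP; exists (n + m)%N.
exists (fun i => match split i with inl j => c * a j | inr j => b j end).
exists (fun i => match split i with inl j => v j | inr j => w j end).
split=> [i|]; first by case: (split i).
rewrite big_split_ord scaler_sumr; congr (_ + _); apply: eq_bigr => i _.
  by rewrite -[lshift m i]/(unsplit (inl i)) unsplitK scalerA.
by rewrite -[rshift n i]/(unsplit (inr i)) unsplitK.
Qed.

HB.instance Definition _ := GRing.isSubmodClosed.Build k V span span_submod.

Definition span_space := {x : V | x \in span}.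

HB.instance Definition _ := SubChoice.on span_space.
HB.instance Definition _ := [SubChoice_isSubLmodule of span_space by <:].

End Span.

(* The tensor product of two vector spaces: the free vector space on V * W     *)
(* modulo the span of the bilinearity relations.                               *)
Section Tensor.
Variables (k : fieldType) (V W : lmodType k).

Let F := {freeg (V * W) / k}.
Let gen (v : V) (w : W) : F := << (v, w) >>.

Inductive tensor_rel : F -> Prop :=
| TensorAddl v v' w : tensor_rel (gen (v + v') w - (gen v w + gen v' w))
| TensorAddr v w w' : tensor_rel (gen v (w + w') - (gen v w + gen v w'))
| TensorScalel a v w : tensor_rel (gen (a *: v) w - a *: gen v w)
| TensorScaler a v w : tensor_rel (gen v (a *: w) - a *: gen v w).

Definition tensor := {quot (span tensor_rel)}.

HB.instance Definition _ := EqQuotient.on tensor.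
HB.instance Definition _ := ZmodQuotient.on tensor.

Definition tensor_scale (a : k) (t : tensor) : tensor :=
  \pi_tensor (a *: repr t).

Lemma pi_tensorP (x y : F) :
  (\pi_tensor x = \pi_tensor y) <-> x - y \in span tensor_rel.
Proof. by rewrite idealrBE; split=> [->|/eqP]. Qed.

Lemma pi_tensor_scale a x :
  tensor_scale a (\pi_tensor x) = \pi_tensor (a *: x).
Proof.
by apply/pi_tensorP; rewrite -scalerBr rpredZ //; apply/pi_tensorP; rewrite reprK.
Qed.

Fact tensor_scaleA a b t :
  tensor_scale a (tensor_scale b t) = tensor_scale (a * b) t.
Proof.
elim/quotW: t => x.
by rewrite (pi_tensor_scale b x) !(pi_tensor_scale _ _) scalerA.
Qed.

Fact tensor_scale1 : left_id 1 tensor_scale.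
Proof. by elim/quotW=> x; rewrite pi_tensor_scale scale1r. Qed.

Fact tensor_scaleDr : right_distributive tensor_scale +%R.
Proof.
move=> a; elim/quotW=> x; elim/quotW=> y.
by rewrite -raddfD !pi_tensor_scale -raddfD scalerDr.
Qed.

Fact tensor_scaleDl t : {morph tensor_scale^~ t : a b / a + b}.
Proof.
by elim/quotW: t => x a b; rewrite !pi_tensor_scale -raddfD scalerDl.
Qed.

HB.instance Definition _ := GRing.Zmodule_isLmodule.Build k tensor
  tensor_scaleA tensor_scale1 tensor_scaleDr tensor_scaleDl.

Lemma pi_tensorZ a x : \pi_tensor (a *: x) = a *: \pi_tensor x.
Proof. by rewrite [RHS]pi_tensor_scale. Qed.

Definition tens (v : V) (w : W) : tensor := \pi_tensor (gen v w).

Fact tens_bilinear : bilinear_for *:%R *:%R tens.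
Proof.
have rel x y : tensor_rel (x - y) -> \pi_tensor x = \pi_tensor y.
  by move=> /mem_span xy; apply/pi_tensorP.
have piD (x y : F) : \pi_tensor (x + y) = \pi_tensor x + \pi_tensor y.
  by rewrite raddfD.
split=> u a v v' /=; rewrite /tens.
  by rewrite (rel _ _ (TensorAddl (a *: v) v' u)) piD
             (rel _ _ (TensorScalel a v u)) pi_tensorZ.
by rewrite (rel _ _ (TensorAddr u (a *: v) v')) piD
           (rel _ _ (TensorScaler a u v)) pi_tensorZ.
Qed.

HB.instance Definition _ :=
  bilinear_isBilinear.Build k V W tensor *:%R *:%R tens tens_bilinear.

(* A decomposition of t as a finite sum of pure tensors. *)
Definition tens_seq (t : tensor) : seq (V * W) :=
  [seq (z.1 *: z.2.1, z.2.2) | z <- fgenum (repr t)].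

Lemma tens_seqK t : \sum_(z <- tens_seq t) tens z.1 z.2 = t.
Proof.
have freegE (s : seq (k * (V * W))) :
    [freeg s] = \sum_(z <- s) z.1 *: << z.2 >> :> F.
  elim: s => [|[a z] s IHs]; first by rewrite big_nil freeg_nil.
  rewrite big_cons -IHs -cat1s freeg_cat; congr (_ + _).
  by apply/eqP/freeg_eqP => y; rewrite coeffZ !coeffU mul1r.
rewrite -[RHS]reprK -[repr t]Freeg_enum freegE raddf_sum big_map.
apply: eq_bigr => -[a [v w]] _.
by rewrite /= linearZl_LR; exact/esym/pi_tensorZ.
Qed.

(* Total on all F; it is independent of the chosen decomposition of t, hence   *)
(* the linear map V ⊗ W -> U induced by F, when F is bilinear (tliftE).        *)
Definition tlift (U : nmodType) (F : V -> W -> U) (t : tensor) : U :=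
  \sum_(z <- tens_seq t) F z.1 z.2.

Section Universal.
Variables (U : lmodType k) (f : V -> W -> U).
Hypothesis f_bilinear : bilinear_for *:%R *:%R f.

Let f' : F -> U := fglift (fun z : V * W => f z.1 z.2).

Let f'_linear : linear f'.
Proof.
have f'B : {morph f' : x y / x - y}.
  exact: (@lift_is_additive k _ U (fun z : V * W => f z.1 z.2)).
pose f'A := GRing.isZmodMorphism.Build F U f' f'B.
pose g : {additive F -> U} := HB.pack f' f'A.
have f'Z a x : f' (a *: x) = a *: f' x.
  rewrite -{2}[x]freeg_sumE -[f']/(g : F -> U) [in RHS]raddf_sum.
  rewrite [_ *: _]/(fgscale a x) raddf_sum scaler_sumr.
  by apply: eq_bigr => z _; rewrite /= /f' !liftU scalerA.
by move=> a x y; rewrite -f'Z -[f']/(g : F -> U) raddfD.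
Qed.

Let f'0 : f' 0 = 0.
Proof. by have := f'_linear (-1) 0 0; rewrite !scaleN1r oppr0 addr0 addNr. Qed.

Let f'Z a x : f' (a *: x) = a *: f' x.
Proof. by have := f'_linear a x 0; rewrite f'0 !addr0. Qed.

Let f'D x y : f' (x + y) = f' x + f' y.
Proof. by have := f'_linear 1 x y; rewrite !scale1r. Qed.

Let f'B x y : f' (x - y) = f' x - f' y.
Proof. by rewrite -[- y]scaleN1r f'D f'Z scaleN1r. Qed.

Let fZl a v w : f (a *: v) w = a *: f v w.
Proof.
have := f_bilinear.1 w a v 0; have := f_bilinear.1 w (-1) 0 0.
by rewrite /= !scaleN1r oppr0 addr0 addNr => ->; rewrite !addr0.
Qed.

Let fZr a v w : f v (a *: w) = a *: f v w.
Proof.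
have := f_bilinear.2 v a w 0; have := f_bilinear.2 v (-1) 0 0.
by rewrite /= !scaleN1r oppr0 addr0 addNr => ->; rewrite !addr0.
Qed.

Let f'_span x : x \in span tensor_rel -> f' x = 0.
Proof.
have fE v w : f' (gen v w) = f v w by rewrite /f' liftU scale1r.
move=> /asboolP[n [a [v [v_rel ->]]]].
rewrite (big_morph f' f'D f'0) big1 // => i _. rewrite f'Z.
apply/eqP; rewrite scaler_eq0; apply/orP; right; apply/eqP.
case: (v_rel i) => [u u' w | u w w' | b u w | b u w];
  rewrite f'B ?f'D ?f'Z !fE; apply/eqP; rewrite subr_eq0; apply/eqP => //.
- by have := f_bilinear.1 w 1 u u'; rewrite /= !scale1r.
- by have := f_bilinear.2 u 1 w w'; rewrite /= !scale1r.
Qed.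

Let tlift_pi x : tlift f (\pi_tensor x) = f' x.
Proof.
have -> : f' x = f' (repr (\pi_tensor x)).
  apply/eqP; rewrite -subr_eq0 -f'B; apply/eqP/f'_span.
  by apply/pi_tensorP; rewrite reprK.
rewrite /tlift big_map -[in RHS](Freeg_enum (repr _)) /f' fglift_Freeg.
by apply: eq_bigr => z _ /=; rewrite fZl.
Qed.

Lemma tlift_linear : linear (tlift f).
Proof.
move=> a; elim/quotW=> x; elim/quotW=> y.
by rewrite -pi_tensorZ -raddfD !tlift_pi f'_linear.
Qed.

Lemma tliftE v w : tlift f (tens v w) = f v w.
Proof. by rewrite tlift_pi /f' liftU scale1r. Qed.

End Universal.
End Tensor.

Notation "v ⊗ w" := (tens v w)
  (at level 40, left associativity) : ring_scope.

(* Sweedler notation: \tsum_(x, y <- t) E is E summed over t = x ⊗ y. Every E   *)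
(* below is bilinear in (x, y), so that tlift_linear and tliftE apply.          *)
Notation "\tsum_ ( x , y <- t ) E" := (tlift (fun x y => E) t)
  (at level 41, E at level 41, x name, y name, t at level 60,
   format "'[' \tsum_ ( x ,  y  <-  t ) '/  '  E ']'") : ring_scope.

Section Structures.
Variable k : fieldType.

(* Algebras may be zero here, unlike the instances of algType.                  *)
Record algebra (A : lmodType k) := Algebra {
  amul : {bilinear A -> A -> A};
  aone : A;
  amulA : associative amul;
  amul1x : left_id aone amul;
  amulx1 : right_id aone amul
}.

(* Triple tensors are bracketed to the right: this is (Δ ⊗ I) Δ followed by the *)
(* associativity isomorphism.                                                   *)
Definition comul2 (C : lmodType k) (D : C -> tensor C C) (c : C) :
    tensor C (tensor C C) :=
  \tsum_(c1, c2 <- D c) \tsum_(c11, c12 <- D c1) c11 ⊗ (c12 ⊗ c2).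

Record coalgebra (C : lmodType k) := Coalgebra {
  comul : {linear C -> tensor C C};
  counit : {scalar C};
  comulA : forall c, comul2 comul c = \tsum_(c1, c2 <- comul c) c1 ⊗ comul c2;
  counitl : forall c, \tsum_(c1, c2 <- comul c) counit c1 *: c2 = c;
  counitr : forall c, \tsum_(c1, c2 <- comul c) counit c2 *: c1 = c
}.

Definition tens_mul (A B : lmodType k) (mA : A -> A -> A) (mB : B -> B -> B)
    (t u : tensor A B) : tensor A B :=
  \tsum_(a, b <- t) \tsum_(a', b' <- u) mA a a' ⊗ mB b b'.

Record weak_bialgebra (H : lmodType k) := WeakBialgebra {
  alg_of :> algebra H;
  coalg_of :> coalgebra H;
  comulM : forall g h, comul coalg_of (amul alg_of g h) =
    tens_mul (amul alg_of) (amul alg_of) (comul coalg_of g) (comul coalg_of h);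
  counitM12 : forall g h l,
    counit coalg_of (amul alg_of (amul alg_of g h) l) =
    \tsum_(h1, h2 <- comul coalg_of h)
      (counit coalg_of (amul alg_of g h1) * counit coalg_of (amul alg_of h2 l));
  counitM21 : forall g h l,
    counit coalg_of (amul alg_of (amul alg_of g h) l) =
    \tsum_(h1, h2 <- comul coalg_of h)
      (counit coalg_of (amul alg_of g h2) * counit coalg_of (amul alg_of h1 l));
  comul1l :
    let m := amul alg_of in let e := aone alg_of in
    let D1_1 := \tsum_(x, y <- comul coalg_of e) x ⊗ (y ⊗ e) in
    tens_mul m (tens_mul m m) (e ⊗ comul coalg_of e) D1_1
    = comul2 (comul coalg_of) e;
  comul1r :
    let m := amul alg_of in let e := aone alg_of in
    let D1_1 := \tsum_(x, y <- comul coalg_of e) x ⊗ (y ⊗ e) in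
    tens_mul m (tens_mul m m) D1_1 (e ⊗ comul coalg_of e)
    = comul2 (comul coalg_of) e
}.

Definition eps_t (H : lmodType k) (B : weak_bialgebra H) (h : H) : H :=
  \tsum_(x, y <- comul B (aone B)) counit B (amul B x h) *: y.

Definition eps_s (H : lmodType k) (B : weak_bialgebra H) (h : H) : H :=
  \tsum_(x, y <- comul B (aone B)) counit B (amul B h y) *: x.

Record weak_hopf (H : lmodType k) := WeakHopf {
  weak_bialg_of :> weak_bialgebra H;
  antipode : {linear H -> H};
  antipode_t : forall h,
    \tsum_(h1, h2 <- comul weak_bialg_of h)
      amul weak_bialg_of h1 (antipode h2) = eps_t weak_bialg_of h;
  antipode_s : forall h,
    \tsum_(h1, h2 <- comul weak_bialg_of h)
      amul weak_bialg_of (antipode h1) h2 = eps_s weak_bialg_of h;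
  antipodeK : forall h,
    \tsum_(h1, h23 <- comul weak_bialg_of h)
    \tsum_(h2, h3 <- comul weak_bialg_of h23)
      amul weak_bialg_of (amul weak_bialg_of (antipode h1) h2) (antipode h3)
    = antipode h
}.

Section Comodules.
Variables (H C : lmodType k) (B : weak_bialgebra H) (rho : {linear C -> tensor H C}).

Definition rho_counital :=
  forall c, \tsum_(x, c0 <- rho c) counit B x *: c0 = c.

Definition rho_coassociative := forall c,
  \tsum_(x, c0 <- rho c) x ⊗ rho c0
  = \tsum_(x, c0 <- rho c) \tsum_(x1, x2 <- comul B x) x1 ⊗ (x2 ⊗ c0).

Record comodule_coalgebra (D : coalgebra C) : Prop := ComoduleCoalgebra {
  cc_counital : rho_counital;
  cc_comul : forall c,
    \tsum_(x, c0 <- rho c) x ⊗ comul D c0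
    = \tsum_(c1, c2 <- comul D c)
      \tsum_(x, d <- rho c1) \tsum_(y, d' <- rho c2) amul B x y ⊗ (d ⊗ d');
  cc_coassociative : rho_coassociative;
  cc_counit : forall c,
    \tsum_(x, c0 <- rho c) counit D c0 *: x
    = \tsum_(x, c0 <- rho c) counit D c0 *: eps_t B x
}.

Record comodule_algebra (A : algebra C) : Prop := ComoduleAlgebra {
  ca_counital : rho_counital;
  ca_coassociative : rho_coassociative;
  ca_mul : forall c d,
    rho (amul A c d) = tens_mul (amul B) (amul A) (rho c) (rho d);
  ca_unit :
    rho (aone A) = \tsum_(x, c0 <- rho (aone A)) eps_s B x ⊗ c0
}.

Definition comodule_bialgebra (E : weak_bialgebra C) : Prop :=
  comodule_coalgebra E /\ comodule_algebra E.

End Comodules.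

Section Cross.
Variables (H C : lmodType k) (B : weak_bialgebra H) (rho : {linear C -> tensor H C}).

Definition cross_tens (c : C) (h : H) : tensor C H :=
  \tsum_(x, c0 <- rho c) \tsum_(h1, h2 <- comul B h)
    counit B (amul B x h1) *: (c0 ⊗ h2).

Definition is_cross (t : tensor C H) : Prop := exists c h, t = cross_tens c h.

Definition cross_space : lmodType k := span_space is_cross.

Fact cross_subproof c h : cross_tens c h \in span is_cross.
Proof. by apply: mem_span; exists c, h. Qed.

Definition cross (c : C) (h : H) : cross_space :=
  (Sub (cross_tens c h) (cross_subproof c h) : span_space is_cross).

Definition cross_incl (t : cross_space) : tensor C H :=
  val (t : span_space is_cross).

Definition tens_comul (D : coalgebra C) (t : tensor C H) :
    tensor (tensor C H) (tensor C H) :=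
  \tsum_(c, h <- t) \tsum_(c1, c2 <- comul D c)
  \tsum_(x, c0 <- rho c2) \tsum_(h1, h2 <- comul B h)
    (c1 ⊗ amul B x h1) ⊗ (c0 ⊗ h2).

End Cross.
End Structures.

(* Main.v *)
Require Import Defs.
From HB Require Import structures.
From mathcomp Require Import all_boot all_algebra.
From mathcomp Require Import boolp.

Set Implicit Arguments.
Unset Strict Implicit.
Unset Printing Implicit Defensive.

Import GRing.Theory.
Local Open Scope ring_scope.

(** Write T and Q for eps_t and eps_s of H, and rho c = x ⊗ c0. As H is
    commutative, ε(x h_1) h_2 = T(x) h, hence c × h = c0 ⊗ T(x) h, where T is
    an algebra endomorphism of H. So c ⊗ h |-> c × h is an idempotent
    multiplicative map on C ⊗ H, and the cross product X is its image. A linear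
    map out of X is determined by its values on the c × h (cross_ext), and the
    one relation between these that matters is
      c × h = c0 × T(x) h                                  (cross_T),
    together with its analogue for products in C (cross_mul_T, cross_mul_T').
    The structure maps of X are therefore defined on C ⊗ H, evaluated on
    generators by this relation, and every axiom is an identity of multilinear
    expressions in generators.

    Most of these identities rest on rho_comul_T: since rho is compatible with
    the coproduct of C and T(y_1) y_2 = y, a coaction on c that is followed by
    T and by a coaction on c_2 may be replaced by separate coactions on c_1
    and c_2. This gives the formula for the coproduct on generators
    (comulX_cross). Coassociativity and the axioms on the counit then reduce
    to those of C and H.

    Two axioms need more. In the axiom on the coproduct of the unit
    (comulX_unit) a factor rho(1) is left over; it lies in H_s ⊗ C, and an
    element z of H_s moves across Δ(1) as T(z) (unit_eps_s), after which the
    relation of generators absorbs it. For S(t_1) t_2 = eps_s(t)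
    (antipodeX_s) the right-hand side is computed on generators in
    eps_sX_cross, using that ε_C(c0) x = ε_C(c0) T(x) and S(x_1) T(x_2) = S(x).
    The antipode is S(c × h) = S(c0) × S(x h), and S is multiplicative on H
    (antipodeM). *)

(** * Multilinear maps and Sweedler sums *)

Section Linear.
Variable k : fieldType.
Implicit Types U V W Z : lmodType k.

(** A predicate on functions, not a bundled map, because it is applied to open
    terms, such as the summand of a Sweedler sum as a function of one of its
    variables. *)
Definition lin V U (f : V -> U) : Prop :=
  forall a x y, f (a *: x + y) = a *: f x + f y.

Definition bilin V W U (f : V -> W -> U) : Prop :=
  (forall w, lin (f^~ w)) /\ (forall v, lin (f v)).

Definition trilin V W Z U (f : V -> W -> Z -> U) : Prop :=
  [/\ forall w z, lin (fun v => f v w z), forall v z, lin (fun w => f v w z) &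
      forall v w, lin (fun z => f v w z)].

Definition quadlin V W V' W' U (f : V -> W -> V' -> W' -> U) : Prop :=
  (forall v w, bilin (f v w)) /\
  (forall v' w', bilin (fun v w => f v w v' w')).

Lemma lin_id V : lin (fun x : V => x).
Proof. by []. Qed.

Lemma lin_map V W U (g : {linear W -> U}) (f : V -> W) :
  lin f -> lin (fun x => g (f x)).
Proof. by move=> lf a x y; rewrite lf linearP. Qed.

Lemma lin_comp V W U (g : W -> U) (f : V -> W) :
  lin g -> lin f -> lin (fun x => g (f x)).
Proof. by move=> lg lf a x y; rewrite lf lg. Qed.

Lemma lin_mapl V W Z U (g : {bilinear W -> Z -> U}) (f : V -> W) z :
  lin f -> lin (fun x => g (f x) z).
Proof. by move=> lf a x y; rewrite lf linearPl. Qed.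

Lemma lin_mapr V W Z U (g : {bilinear W -> Z -> U}) (f : V -> Z) w :
  lin f -> lin (fun x => g w (f x)).
Proof. by move=> lf a x y; rewrite lf linearPr. Qed.

Lemma lin_tensl V W Z (f : V -> W) (z : Z) : lin f -> lin (fun x => f x ⊗ z).
Proof. by move=> lf a x y; rewrite lf linearPl. Qed.

Lemma lin_tensr V W Z (f : V -> Z) (w : W) : lin f -> lin (fun x => w ⊗ f x).
Proof. by move=> lf a x y; rewrite lf linearPr. Qed.

Lemma lin_scaler V U (f : V -> U) (c : k) : lin f -> lin (fun x => c *: f x).
Proof. by move=> lf a x y; rewrite lf scalerDr !scalerA mulrC. Qed.

Lemma lin_scalel V W U (e : {scalar W}) (f : V -> W) (u : U) :
  lin f -> lin (fun x => e (f x) *: u).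
Proof. by move=> lf a x y; rewrite lf linearP scalerDl scalerA. Qed.

Section Tlift.
Variables V W : lmodType k.

Lemma lin_bilinear U (f : V -> W -> U) : bilin f -> bilinear_for *:%R *:%R f.
Proof. by move=> [fl fr]; split=> u a x y; [apply: fl | apply: fr]. Qed.

Lemma tsum_tens U (f : V -> W -> U) v w :
  bilin f -> \tsum_(x, y <- v ⊗ w) f x y = f v w.
Proof. by move=> /lin_bilinear bf; apply: tliftE. Qed.

Lemma eq_tsum U (f g : V -> W -> U) t :
  (forall x y, f x y = g x y) ->
  \tsum_(x, y <- t) f x y = \tsum_(x, y <- t) g x y.
Proof. by move=> fg; apply: eq_bigr. Qed.

Lemma lin_tsum_arg Z U (f : V -> W -> U) (t : Z -> tensor V W) :
  bilin f -> lin t -> lin (fun z => \tsum_(x, y <- t z) f x y).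
Proof.
by move=> /lin_bilinear bf lt a x y; rewrite lt (tlift_linear bf).
Qed.

Lemma lin_tsum Z U (f : Z -> V -> W -> U) (t : tensor V W) :
  (forall x y, lin (fun z => f z x y)) ->
  lin (fun z => \tsum_(x, y <- t) f z x y).
Proof.
move=> lf a x y; rewrite /tlift scaler_sumr -big_split.
by apply: eq_bigr => z _; apply: lf.
Qed.

Lemma lin0 U Z (g : U -> Z) : lin g -> g 0 = 0.
Proof. by move=> /(_ (-1) 0 0); rewrite !scaleN1r oppr0 addr0 addNr. Qed.

Lemma map_tsum U Z (g : U -> Z) (f : V -> W -> U) (t : tensor V W) :
  lin g -> g (\tsum_(x, y <- t) f x y) = \tsum_(x, y <- t) g (f x y).
Proof.
move=> lg; have g0 := lin0 lg.
have gD x y : g (x + y) = g x + g y by have := lg 1 x y; rewrite !scale1r.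
exact: (big_morph g gD g0).
Qed.

Lemma tsum_tensK t : \tsum_(x, y <- t) x ⊗ y = t :> tensor V W.
Proof. exact: tens_seqK. Qed.

Lemma scale_tsum U (f : V -> W -> U) a t :
  a *: (\tsum_(x, y <- t) f x y) = \tsum_(x, y <- t) a *: f x y.
Proof. exact: scaler_sumr. Qed.

Lemma exch_tsum V' W' U (f : V -> W -> V' -> W' -> U) t t' :
  \tsum_(x, y <- t) \tsum_(x', y' <- t') f x y x' y' =
  \tsum_(x', y' <- t') \tsum_(x, y <- t) f x y x' y'.
Proof. exact: exchange_big. Qed.

End Tlift.

Lemma lin_sum U Z (g : U -> Z) n (a : 'I_n -> k) (u : 'I_n -> U) :
  lin g -> g (\sum_(i < n) a i *: u i) = \sum_(i < n) a i *: g (u i).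
Proof.
move=> lg; have g0 := lin0 lg.
have gD x y : g (x + y) = g x + g y by have := lg 1 x y; rewrite !scale1r.
rewrite (big_morph g gD g0); apply: eq_bigr => i _.
by have := lg (a i) (u i) 0; rewrite g0 !addr0.
Qed.

Lemma tsum_tsum V W V' W' U (f : V -> W -> U)
    (g : V' -> W' -> tensor V W) t :
  bilin f ->
  \tsum_(x, y <- \tsum_(x', y' <- t) g x' y') f x y =
  \tsum_(x', y' <- t) \tsum_(x, y <- g x' y') f x y.
Proof.
move=> bf; apply: (map_tsum (g := fun s => \tsum_(x, y <- s) f x y)).
exact: (lin_tsum_arg bf (@lin_id _)).
Qed.

Lemma linZ V U (g : V -> U) a x : lin g -> g (a *: x) = a *: g x.
Proof. by move=> lg; have := lg a x 0; rewrite (lin0 lg) !addr0. Qed.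

End Linear.

Section Bundle.
Variables (k : fieldType) (V W U : lmodType k).

Definition linear_of (f : V -> U) (lf : lin f) : {linear V -> U} :=
  let fL := GRing.isLinear.Build k V U *:%R f lf in HB.pack f fL.

Definition scalar_of (f : V -> k^o) (lf : lin f) : {scalar V} :=
  let fL := GRing.isLinear.Build k V k *%R f lf in HB.pack (f : V -> k) fL.

Definition bilinear_of (f : V -> W -> U) (bf : bilin f) :
    {bilinear V -> W -> U} :=
  let fB := bilinear_isBilinear.Build k V W U *:%R *:%R f (lin_bilinear bf) in
  HB.pack f fB.

End Bundle.

(** A hook for the linear maps that are introduced later on. *)
Ltac lin_user := fail.

(** Proves that a term is linear in a variable by following its syntax, down to
    functions that are multilinear by assumption. *)
Ltac lin :=
  lazymatch goal with
  | |- forall _, _ => intro; lin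
  | |- bilin _ => split; intro; lin
  | |- trilin _ => split; intros ? ?; lin
  | |- quadlin _ => split; intros ? ?; lin
  | |- lin ?f =>
    change (lin (fun z => f z)); cbv beta;
    first
    [ exact: lin_id
    | simple apply lin_tensl; lin
    | simple apply lin_tensr; lin
    | simple apply lin_scalel; lin
    | simple apply lin_scaler; lin
    | simple apply lin_map; lin
    | simple apply lin_mapl; lin
    | simple apply lin_mapr; lin
    | simple apply lin_tsum; lin
    | simple apply lin_tsum_arg; lin
    | lin_user
    | lin_var ]
  end
with lin_var :=
  match goal with
  | h : lin ?F |- lin (fun z => ?F (@?g z)) => apply: (lin_comp h); lin
  | h : bilin ?F |- lin (fun z => ?F (@?g z) ?b) =>
    apply: (lin_comp (h.1 b)); lin
  | h : bilin ?F |- lin (fun z => ?F ?a (@?g z)) =>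
    apply: (lin_comp (h.2 a)); lin
  | h : trilin ?F |- lin (fun z => ?F (@?g z) ?b ?c) =>
    let l := fresh in case: h => [l _ _]; apply: (lin_comp (l b c)); lin
  | h : trilin ?F |- lin (fun z => ?F ?a (@?g z) ?c) =>
    let l := fresh in case: h => [_ l _]; apply: (lin_comp (l a c)); lin
  | h : trilin ?F |- lin (fun z => ?F ?a ?b (@?g z)) =>
    let l := fresh in case: h => [_ _ l]; apply: (lin_comp (l a b)); lin
  | h : quadlin ?F |- lin (fun z => ?F (@?g z) ?b ?c ?d) =>
    apply: (lin_comp ((h.2 c d).1 b)); lin
  | h : quadlin ?F |- lin (fun z => ?F ?a (@?g z) ?c ?d) =>
    apply: (lin_comp ((h.2 c d).2 a)); lin
  | h : quadlin ?F |- lin (fun z => ?F ?a ?b (@?g z) ?d) =>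
    apply: (lin_comp ((h.1 a b).1 d)); lin
  | h : quadlin ?F |- lin (fun z => ?F ?a ?b ?c (@?g z)) =>
    apply: (lin_comp ((h.1 a b).2 c)); lin
  end.

Section TensMul.
Variables (k : fieldType) (A B : lmodType k).
Variables (mA : A -> A -> A) (mB : B -> B -> B).
Hypotheses (bA : bilin mA) (bB : bilin mB).

Lemma bilin_tens_mul : bilin (tens_mul mA mB).
Proof.
have [lA rA] := bA; have [lB rB] := bB; have [lt rt] := @tens_bilinear k A B.
have b1 a b : bilin (fun a' b' => mA a a' ⊗ mB b b').
  by split=> u; [apply: lin_tensl | apply: lin_tensr].
split=> u; rewrite /tens_mul.
  apply: lin_tsum_arg (@lin_id _ _).
  by split=> v; apply: lin_tsum => *; [apply: lin_tensl | apply: lin_tensr].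
by apply: lin_tsum => a b; apply: lin_tsum_arg (@lin_id _ _).
Qed.

Lemma tens_mulE a b a' b' :
  tens_mul mA mB (a ⊗ b) (a' ⊗ b') = mA a a' ⊗ mB b b'.
Proof.
have [lA rA] := bA; have [lB rB] := bB.
rewrite /tens_mul tsum_tens ?tsum_tens //; split=> u.
- exact: lin_tensl.
- exact: lin_tensr.
- by apply: lin_tsum => *; apply: lin_tensl.
- by apply: lin_tsum => *; apply: lin_tensr.
Qed.

Lemma tens_mul_tsum (V W V' W' : lmodType k) (f : V -> W -> tensor A B)
    (g : V' -> W' -> tensor A B) (t : tensor V W) (t' : tensor V' W') :
  tens_mul mA mB (\tsum_(x, y <- t) f x y) (\tsum_(x', y' <- t') g x' y') =
  \tsum_(x, y <- t) \tsum_(x', y' <- t') tens_mul mA mB (f x y) (g x' y').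
Proof.
have [l r] := bilin_tens_mul.
rewrite (map_tsum _ _ (l _)); apply: eq_tsum => x y.
by rewrite (map_tsum _ _ (r _)).
Qed.

End TensMul.

Lemma bilin_map (k : fieldType) (V W U : lmodType k)
  (g : {bilinear V -> W -> U}) : bilin g.
Proof. by split=> u; lin. Qed.

Lemma tens_tsumr (k : fieldType) (V W Z U : lmodType k) (z : Z)
    (f : V -> W -> U) (t : tensor V W) :
  z ⊗ (\tsum_(x, y <- t) f x y) = \tsum_(x, y <- t) z ⊗ f x y.
Proof. by apply: (map_tsum (g := tens z)); lin. Qed.

Section Algebra.
Variables (k : fieldType) (A : lmodType k) (m : algebra A).

Let bm := bilin_map (amul m).
Let bmm := bilin_tens_mul bm bm.

(** The products in the axioms on the coproduct t of the unit, in a form on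
    which a trilinear map is evaluated term by term. *)
Lemma unit_tens_mul_l t :
  tens_mul (amul m) (tens_mul (amul m) (amul m)) (aone m ⊗ t)
    (\tsum_(x, y <- t) x ⊗ (y ⊗ aone m)) =
  \tsum_(x, y <- t) \tsum_(x', y' <- t) x ⊗ (amul m x' y ⊗ y').
Proof.
rewrite -[in X in tens_mul _ _ X](tsum_tensK t) tens_tsumr tens_mul_tsum //.
rewrite exch_tsum; apply: eq_tsum => x y; apply: eq_tsum => x' y'.
by rewrite !tens_mulE // amul1x amulx1.
Qed.

Lemma unit_tens_mul_r t :
  tens_mul (amul m) (tens_mul (amul m) (amul m))
    (\tsum_(x, y <- t) x ⊗ (y ⊗ aone m)) (aone m ⊗ t) =
  \tsum_(x, y <- t) \tsum_(x', y' <- t) x ⊗ (amul m y x' ⊗ y').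
Proof.
rewrite -[in X in tens_mul _ _ _ X](tsum_tensK t) tens_tsumr tens_mul_tsum //.
apply: eq_tsum => x y; apply: eq_tsum => x' y'.
by rewrite !tens_mulE // amul1x amulx1.
Qed.

End Algebra.

Section Triple.
Variables (k : fieldType) (V W Z U : lmodType k) (F : V -> W -> Z -> U).
Hypothesis tF : trilin F.

(** The linear extension of a trilinear map to triple tensors. *)
Definition tsum3 (t : tensor V (tensor W Z)) : U :=
  \tsum_(x, s <- t) \tsum_(y, z <- s) F x y z.

Let bF x : bilin (F x). Proof. by lin. Qed.

Let bF3 : bilin (fun x (s : tensor W Z) => \tsum_(y, z <- s) F x y z).
Proof. by lin. Qed.

Lemma tsum3_tsum (A B : lmodType k) (f : A -> B -> tensor V (tensor W Z)) t :
  tsum3 (\tsum_(x, y <- t) f x y) = \tsum_(x, y <- t) tsum3 (f x y).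
Proof. exact: tsum_tsum. Qed.

Lemma tsum3_tens x s : tsum3 (x ⊗ s) = \tsum_(y, z <- s) F x y z.
Proof. exact: tsum_tens. Qed.

Lemma tsum3_pure x y z : tsum3 (x ⊗ (y ⊗ z)) = F x y z.
Proof. by rewrite tsum3_tens tsum_tens. Qed.

Lemma tsum3_comul2 (C : lmodType k) (D : C -> tensor C C) c
    (f : C -> V) (g : C -> W) (h : C -> Z) :
  tsum3 (\tsum_(c1, c2 <- D c) \tsum_(c11, c12 <- D c1)
    f c11 ⊗ (g c12 ⊗ h c2)) =
  \tsum_(c1, c2 <- D c) \tsum_(c11, c12 <- D c1) F (f c11) (g c12) (h c2).
Proof.
rewrite tsum3_tsum; apply: eq_tsum => x y; rewrite tsum3_tsum.
by apply: eq_tsum => x' y'; rewrite tsum3_pure.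
Qed.

End Triple.

(** * Rewriting inside nested Sweedler sums *)

(** Runs tac at the outermost depth of a nested Sweedler sum at which tac
    succeeds. The tactics below replace the left-hand side of an equation:
    sw l by an instance of the equation l between Sweedler sums, whose
    multilinear hypotheses are discharged by lin; swl l by the same from right
    to left; swr l and swrl l rewrite within the term found at that depth. The
    variants with a number n act under exactly n sums. *)
Ltac under_tsum tac :=
  first [ tac | refine (eq_tsum _ _); intros ? ?; under_tsum tac ].

Ltac sweedler tac := etransitivity; [ under_tsum tac | cbv beta ].

Tactic Notation "sw" uconstr(l) := sweedler ltac:(eapply l; lin).
Tactic Notation "swl" uconstr(l) := sweedler ltac:(symmetry; eapply l; lin).
Tactic Notation "swr" uconstr(l) := sweedler ltac:(rewrite l; reflexivity).
Tactic Notation "swrl" uconstr(l) := sweedler ltac:(rewrite -l; reflexivity).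
Tactic Notation "sw" uconstr(l) "at" integer(n) :=
  etransitivity;
  [ do n (refine (eq_tsum _ _); intros ? ?); eapply l; lin | cbv beta ].
Tactic Notation "swl" uconstr(l) "at" integer(n) :=
  etransitivity;
  [ do n (refine (eq_tsum _ _); intros ? ?); symmetry; eapply l; lin
  | cbv beta ].

(* The arguments of a Sweedler identity are to be found by unification, also
   those that occur in its conclusion only. *)
Set Contextual Implicit.

(** * Weak bialgebras *)

Section WeakBialgebra.
Variables (k : fieldType) (H : lmodType k) (B : weak_bialgebra H).
Implicit Types U V : lmodType k.

Local Notation "x ∙ y" := (amul B x y) (at level 40, left associativity).
Local Notation "'e'" := (aone B).
Local Notation Δ := (comul B).
Local Notation ε := (counit B).
Local Notation T := (eps_t B).
Local Notation Q := (eps_s B).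

Lemma coassoc U (F : H -> H -> H -> U) c :
  trilin F ->
  \tsum_(x, y <- Δ c) \tsum_(x1, x2 <- Δ x) F x1 x2 y =
  \tsum_(x, y <- Δ c) \tsum_(y1, y2 <- Δ y) F x y1 y2.
Proof.
move=> tF; rewrite -(tsum3_comul2 tF _ _ id id id) [X in tsum3 _ X]comulA.
rewrite tsum3_tsum //; apply: eq_tsum => x y; exact: tsum3_tens.
Qed.

Lemma comul_mul U (F : H -> H -> U) g h : bilin F ->
  \tsum_(x, y <- Δ (g ∙ h)) F x y =
  \tsum_(x, y <- Δ g) \tsum_(x', y' <- Δ h) F (x ∙ x') (y ∙ y').
Proof.
move=> bF; rewrite comulM tsum_tsum //; apply: eq_tsum => x y.
by rewrite tsum_tsum //; apply: eq_tsum => x' y'; rewrite tsum_tens.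
Qed.

Lemma counit_l U (f : H -> U) c : lin f ->
  \tsum_(x, y <- Δ c) ε x *: f y = f c.
Proof.
move=> lf; rewrite -[in RHS](counitl B c) (map_tsum _ _ lf).
by apply: eq_tsum => x y; rewrite linZ.
Qed.

Lemma counit_r U (f : H -> U) c : lin f ->
  \tsum_(x, y <- Δ c) ε y *: f x = f c.
Proof.
move=> lf; rewrite -[in RHS](counitr B c) (map_tsum _ _ lf).
by apply: eq_tsum => x y; rewrite linZ.
Qed.

Lemma counit12 U (v : U) g h l :
  \tsum_(x, y <- Δ h) ε (g ∙ x) *: (ε (y ∙ l) *: v) = ε (g ∙ h ∙ l) *: v.
Proof.
rewrite counitM12 /tlift scaler_suml.
by apply: eq_bigr => z _; rewrite scalerA.
Qed.

Lemma counit21 U (v : U) g h l :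
  \tsum_(x, y <- Δ h) ε (g ∙ y) *: (ε (x ∙ l) *: v) = ε (g ∙ h ∙ l) *: v.
Proof.
rewrite counitM21 /tlift scaler_suml.
by apply: eq_bigr => z _; rewrite scalerA.
Qed.

Lemma comul_unit_l U (F : H -> H -> H -> U) :
  trilin F ->
  \tsum_(x, y <- Δ e) \tsum_(y1, y2 <- Δ y) F x y1 y2 =
  \tsum_(x, y <- Δ e) \tsum_(x', y' <- Δ e) F x (x' ∙ y) y'.
Proof.
move=> tF; rewrite -coassoc // -(tsum3_comul2 tF _ _ id id id).
rewrite -[X in tsum3 _ X]comul1l unit_tens_mul_l tsum3_tsum //.
apply: eq_tsum => x y; rewrite tsum3_tsum //.
by apply: eq_tsum => x' y'; rewrite tsum3_pure.
Qed.

Lemma comul_unit_r U (F : H -> H -> H -> U) :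
  trilin F ->
  \tsum_(x, y <- Δ e) \tsum_(y1, y2 <- Δ y) F x y1 y2 =
  \tsum_(x, y <- Δ e) \tsum_(x', y' <- Δ e) F x (y ∙ x') y'.
Proof.
move=> tF; rewrite -coassoc // -(tsum3_comul2 tF _ _ id id id).
rewrite -[X in tsum3 _ X]comul1r unit_tens_mul_r tsum3_tsum //.
apply: eq_tsum => x y; rewrite tsum3_tsum //.
by apply: eq_tsum => x' y'; rewrite tsum3_pure.
Qed.

Lemma lin_eps_t V (f : V -> H) : lin f -> lin (fun x => T (f x)).
Proof. by move=> lf; rewrite /eps_t; apply: lin_tsum => x y; lin; exact: lf. Qed.

Lemma lin_eps_s V (f : V -> H) : lin f -> lin (fun x => Q (f x)).
Proof. by move=> lf; rewrite /eps_s; apply: lin_tsum => x y; lin; exact: lf. Qed.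

Ltac lin_user ::=
  first [simple apply lin_eps_t; lin | simple apply lin_eps_s; lin].

Lemma map_eps_t U (f : H -> U) h : lin f ->
  f (T h) = \tsum_(x, y <- Δ e) ε (x ∙ h) *: f y.
Proof.
by move=> lf; rewrite (map_tsum _ _ lf); apply: eq_tsum => x y; rewrite linZ.
Qed.

Lemma map_eps_s U (f : H -> U) h : lin f ->
  f (Q h) = \tsum_(x, y <- Δ e) ε (h ∙ y) *: f x.
Proof.
by move=> lf; rewrite (map_tsum _ _ lf); apply: eq_tsum => x y; rewrite linZ.
Qed.

Lemma comul_mul1 U (F : H -> H -> U) h : bilin F ->
  \tsum_(x, y <- Δ h) \tsum_(x', y' <- Δ e) F (x ∙ x') (y ∙ y') =
  \tsum_(x, y <- Δ h) F x y.
Proof. by move=> bF; swl comul_mul; rewrite amulx1. Qed.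

Lemma comul_1mul U (F : H -> H -> U) h : bilin F ->
  \tsum_(x, y <- Δ e) \tsum_(x', y' <- Δ h) F (x ∙ x') (y ∙ y') =
  \tsum_(x, y <- Δ h) F x y.
Proof. by move=> bF; swl comul_mul; rewrite amul1x. Qed.

(** As eps_t h = ε(1_1 h) 1_2, the left-hand side is a sum over the iterated
    coproduct of 1. Each of the two expressions for the latter gives one of
    the positions of eps_t h in this lemma and the next. *)
Lemma comul_eps_t U (F : H -> H -> U) h : bilin F ->
  \tsum_(x, y <- Δ (T h)) F x y = \tsum_(x, y <- Δ e) F (x ∙ T h) y.
Proof.
move=> bF; sw (map_eps_t (f := fun z => \tsum_(x, y <- Δ z) F x y)).
sw scale_tsum; sw comul_unit_l; sw exch_tsum; symmetry.
by sw (map_eps_t (f := fun z => F (_ ∙ z) _)).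
Qed.

Lemma comul_eps_t' U (F : H -> H -> U) h : bilin F ->
  \tsum_(x, y <- Δ (T h)) F x y = \tsum_(x, y <- Δ e) F (T h ∙ x) y.
Proof.
move=> bF; sw (map_eps_t (f := fun z => \tsum_(x, y <- Δ z) F x y)).
sw scale_tsum; sw comul_unit_r; sw exch_tsum; symmetry.
by sw (map_eps_t (f := fun z => F (z ∙ _) _)).
Qed.

Lemma comul_eps_s U (F : H -> H -> U) h : bilin F ->
  \tsum_(x, y <- Δ (Q h)) F x y = \tsum_(x, y <- Δ e) F x (Q h ∙ y).
Proof.
move=> bF; sw (map_eps_s (f := fun z => \tsum_(x, y <- Δ z) F x y)).
sw scale_tsum; sw coassoc; sw comul_unit_l; symmetry.
by sw (map_eps_s (f := fun z => F _ (z ∙ _))).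
Qed.

Lemma comul_mul_eps_t U (F : H -> H -> U) g h : bilin F ->
  \tsum_(x, y <- Δ (g ∙ T h)) F x y = \tsum_(x, y <- Δ g) F (x ∙ T h) y.
Proof.
move=> bF; sw comul_mul; sw comul_eps_t; swr amulA.
by sw (comul_mul1 (F := fun x y => F (x ∙ T h) y)).
Qed.

Lemma comul_eps_t_mul U (F : H -> H -> U) g h : bilin F ->
  \tsum_(x, y <- Δ (T h ∙ g)) F x y = \tsum_(x, y <- Δ g) F (T h ∙ x) y.
Proof.
move=> bF; sw comul_mul; sw comul_eps_t'; swrl amulA.
by sw (comul_1mul (F := fun x y => F (T h ∙ x) y)).
Qed.

Lemma comul_eps_s_mul U (F : H -> H -> U) g h : bilin F ->
  \tsum_(x, y <- Δ (Q h ∙ g)) F x y = \tsum_(x, y <- Δ g) F x (Q h ∙ y).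
Proof.
move=> bF; sw comul_mul; sw comul_eps_s; swrl amulA.
by sw (comul_1mul (F := fun x y => F x (Q h ∙ y))).
Qed.

(** This is the axiom for ε(g 1 h) that pairs g with 1_2, read backwards. *)
Lemma counit_eps_t U (v : U) g h : ε (g ∙ T h) *: v = ε (g ∙ h) *: v.
Proof.
sw (map_eps_t (f := fun z => ε (g ∙ z) *: v)).
rewrite -[g in RHS](amulx1 B) -counit21; apply: eq_tsum => x y.
by rewrite !scalerA mulrC.
Qed.

Lemma counit_eps_s U (v : U) g h : ε (Q g ∙ h) *: v = ε (g ∙ h) *: v.
Proof.
sw (map_eps_s (f := fun z => ε (z ∙ h) *: v)).
by rewrite -[g in RHS](amulx1 B) -counit21.
Qed.

(** The counit sees only eps_t h, which can be moved into the coproduct by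
    comul_mul_eps_t, and then the counit law applies. *)
Lemma counit_comul_t U (f : H -> U) g h : lin f ->
  \tsum_(x, y <- Δ g) ε (x ∙ h) *: f y = f (g ∙ T h).
Proof.
move=> lf; swl counit_eps_t.
by swl (comul_mul_eps_t (F := fun x y => ε x *: f y)); sw counit_l.
Qed.

Lemma counit_comul_s U (f : H -> U) g h : lin f ->
  \tsum_(x, y <- Δ g) ε (h ∙ y) *: f x = f (Q h ∙ g).
Proof.
move=> lf; swl counit_eps_s.
by swl (comul_eps_s_mul (F := fun x y => ε y *: f x)); sw counit_r.
Qed.

(** Both sides arise from 1_1 h_1 ⊗ 1_2 h_2 ⊗ 1_3 by applying ε to the middle
    factor: directly, and after splitting the iterated coproduct of 1 into two
    copies of Δ(1). *)
Lemma comul_eps_t_snd U (F : H -> H -> U) h : bilin F ->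
  \tsum_(x, y <- Δ h) F x (T y) = \tsum_(x, y <- Δ e) F (x ∙ h) y.
Proof.
move=> bF; symmetry.
swl (counit_r (f := fun z => F z _)); sw comul_mul.
sw (coassoc (F := fun a b c =>
  \tsum_(x', y' <- Δ h) counit B (b ∙ y') *: F (a ∙ x') c)).
sw comul_unit_l.
sw exch_tsum.
swrl amulA.
sw (comul_1mul (F := fun a b => ε (_ ∙ b) *: F a _)) at 1.
sw exch_tsum; symmetry.
by sw (map_eps_t (f := fun z => F _ z)).
Qed.

(** ε(1_1 h_1) 1_2 h_2 is the counit law for the product 1 h. *)
Lemma eps_t_mul_comul U (f : H -> U) h : lin f ->
  \tsum_(x, y <- Δ h) f (T x ∙ y) = f h.
Proof.
move=> lf; sw (map_eps_t (f := fun z => f (z ∙ _))).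
sw exch_tsum; swl (comul_mul (F := fun x y => ε x *: f y)); sw counit_l.
by rewrite amul1x.
Qed.

End WeakBialgebra.

Ltac lin_user ::=
  first [simple apply lin_eps_t; lin | simple apply lin_eps_s; lin].

(** * Commutative weak Hopf algebras *)

Section Commutative.
Variables (k : fieldType) (H : lmodType k) (B : weak_hopf H).
Implicit Types U V : lmodType k.

Local Notation "x ∙ y" := (amul B x y) (at level 40, left associativity).
Local Notation "'e'" := (aone B).
Local Notation Δ := (comul B).
Local Notation ε := (counit B).
Local Notation T := (eps_t B).
Local Notation Q := (eps_s B).
Local Notation S := (antipode B).

Hypothesis amulC : forall x y, x ∙ y = y ∙ x.
Arguments amulC x y : clear implicits.

Lemma amulAC x y z : x ∙ y ∙ z = x ∙ z ∙ y.
Proof. by rewrite -!amulA [y ∙ z]amulC. Qed.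

Lemma amulCA x y z : x ∙ (y ∙ z) = y ∙ (x ∙ z).
Proof. by rewrite !amulA [x ∙ y]amulC. Qed.

Lemma amulACA x y z t : x ∙ y ∙ (z ∙ t) = x ∙ z ∙ (y ∙ t).
Proof. by rewrite !amulA [x ∙ y ∙ z]amulAC. Qed.

(** eps_t h eps_t g = ε(1_1 eps_t(h) g) 1_2, and the counit does not
    distinguish eps_t h from h. *)
Lemma eps_t_mul g h : T (g ∙ h) = T g ∙ T h.
Proof.
rewrite [RHS]amulC -(counit_comul_t (f := fun z => z)) // comul_eps_t.
rewrite [LHS]/eps_t; apply: eq_tsum => x y.
by rewrite amulAC counit_eps_t amulA.
lin.
Qed.

Lemma eps_s_mul g h : Q (g ∙ h) = Q g ∙ Q h.
Proof.
rewrite -(counit_comul_s (f := fun z => z)) // comul_eps_s.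
rewrite [LHS]/eps_s; apply: eq_tsum => x y.
by rewrite amulCA counit_eps_s amulA [g ∙ h]amulC.
lin.
Qed.

(** By comul_eps_t_snd the sum is T(1_1 h) 1_2 = T(1_1) 1_2 T(h), and
    T(1_1) 1_2 = 1. *)
Lemma eps_t_comul U (f : H -> U) h : lin f ->
  \tsum_(x, y <- Δ h) f (T x ∙ T y) = f (T h).
Proof.
move=> lf; sw (comul_eps_t_snd (F := fun x y => f (T x ∙ y))).
swr eps_t_mul; swr amulAC.
sw (eps_t_mul_comul (f := fun z => f (z ∙ T h))).
by rewrite amul1x.
Qed.

(** With z = Q g, both sides are the sum of F(z_1, T(z_2)) over the coproduct
    of z: the left one by comul_eps_t_snd, the right one by Δ(z) = 1_1 ⊗ z 1_2. *)
Lemma unit_eps_s U (F : H -> H -> U) g : bilin F ->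
  \tsum_(x, y <- Δ e) F (Q g ∙ x) y =
  \tsum_(x, y <- Δ e) F x (T (Q g) ∙ y).
Proof.
move=> bF; swr (amulC (Q g)). swl comul_eps_t_snd. sw comul_eps_s.
swr eps_t_mul. sw (comul_eps_t_snd (F := fun x y => F x (T (Q g) ∙ y))).
by swr amulx1.
Qed.

(** In S(h_1) h_2 S(h_3) = S(h), the last two factors give eps_t here, and the
    first two give eps_s in eps_s_mul_antipode. *)
Lemma antipode_mul_eps_t U (f : H -> U) h : lin f ->
  \tsum_(x, y <- Δ h) f (S x ∙ T y) = f (S h).
Proof.
move=> lf; rewrite -antipodeK; symmetry.
sw map_tsum. sw map_tsum. swrl amulA.
swl (map_tsum (g := fun z => f (_ ∙ z))).
by swr antipode_t.
Qed.

Lemma eps_s_mul_antipode U (f : H -> U) h : lin f ->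
  \tsum_(x, y <- Δ h) f (Q x ∙ S y) = f (S h).
Proof.
move=> lf; rewrite -antipodeK; symmetry.
sw map_tsum. sw map_tsum.
swl (coassoc (F := fun x y z => f (S x ∙ y ∙ S z))).
swl (map_tsum (g := fun z => f (z ∙ _))).
by swr antipode_s.
Qed.

Lemma map_antipode_t U (f : H -> U) h : lin f ->
  \tsum_(x, y <- Δ h) f (x ∙ S y) = f (T h).
Proof. by move=> lf; rewrite -antipode_t; symmetry; sw map_tsum. Qed.

Lemma map_antipode_s U (f : H -> U) h : lin f ->
  \tsum_(x, y <- Δ h) f (S x ∙ y) = f (Q h).
Proof. by move=> lf; rewrite -antipode_s; symmetry; sw map_tsum. Qed.

(** S(g h) = S(g_1 h_1) T(g_2 h_2), where T(g_2 h_2) is expanded as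
    g_2 S(g_3) h_2 S(h_3). Commutativity brings S(g_1 h_1) next to g_2 h_2,
    which gives Q(g_1) Q(h_1) S(g_2) S(h_2). *)
Lemma antipodeM g h : S (g ∙ h) = S g ∙ S h.
Proof.
swl (antipode_mul_eps_t (f := fun z => z)); sw comul_mul; swr eps_t_mul.
swl (map_antipode_t (f := fun z => _ ∙ (z ∙ _))).
swl (map_antipode_t (f := fun z => _ ∙ (_ ∙ z))).
sw exch_tsum at 1.
swl (coassoc (F := fun a b c =>
   \tsum_(x, y <- Δ h) \tsum_(y1, y2 <- Δ y)
     S (a ∙ x) ∙ (b ∙ S c ∙ (y1 ∙ S y2)))).
swl (coassoc (F := fun a b c => S (_ ∙ a) ∙ (_ ∙ S _ ∙ (b ∙ S c)))) at 2.
swr amulACA; swr amulA.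
sw exch_tsum at 1.
swl (comul_mul (F := fun a b => S a ∙ b ∙ _)).
sw (map_antipode_s (f := fun z => z ∙ _)).
swr eps_s_mul; swr amulACA.
sw (eps_s_mul_antipode (f := fun z => _ ∙ z)).
by sw (eps_s_mul_antipode (f := fun z => z ∙ _)).
Qed.

End Commutative.

(** * Comodule bialgebras over a commutative weak Hopf algebra *)

Section Coaction.
Variables (k : fieldType) (C H : lmodType k).
Variables (wC : weak_hopf C) (wH : weak_hopf H) (rho : {linear C -> tensor H C}).
Hypothesis rho_bialg : comodule_bialgebra wH rho wC.
Hypothesis amulC : forall g h : H, amul wH g h = amul wH h g.
Arguments amulC g h : clear implicits.
Set Contextual Implicit.

Implicit Types (U V : lmodType k) (c d : C) (g h l : H).

Local Notation "x ∙ y" := (amul wH x y) (at level 40, left associativity).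
Local Notation "x ⋆ y" := (amul wC x y) (at level 40, left associativity).
Local Notation T := (eps_t wH).
Local Notation Q := (eps_s wH).
Local Notation S := (antipode wH).

Lemma rho_coassoc U (F : H -> H -> C -> U) c : trilin F ->
  \tsum_(x, c0 <- rho c) \tsum_(y, d <- rho c0) F x y d =
  \tsum_(x, c0 <- rho c) \tsum_(x1, x2 <- comul wH x) F x1 x2 c0.
Proof.
move=> tF; have := congr1 (tsum3 F) (cc_coassociative rho_bialg.1 c).
rewrite !tsum3_tsum // => E; etransitivity.
  by apply: eq_tsum => x c0; symmetry; apply: (tsum3_tens tF).
rewrite E; apply: eq_tsum => x c0; rewrite tsum3_tsum //.
by apply: eq_tsum => x1 x2; rewrite tsum3_pure.
Qed.

Lemma rho_comul U (F : H -> C -> C -> U) c : trilin F ->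
  \tsum_(x, c0 <- rho c) \tsum_(d, d' <- comul wC c0) F x d d' =
  \tsum_(c1, c2 <- comul wC c) \tsum_(x, d <- rho c1)
    \tsum_(y, d' <- rho c2) F (x ∙ y) d d'.
Proof.
move=> tF; have := congr1 (tsum3 F) (cc_comul rho_bialg.1 c).
rewrite !tsum3_tsum // => E; etransitivity.
  by apply: eq_tsum => x c0; symmetry; apply: (tsum3_tens tF).
rewrite E; apply: eq_tsum => c1 c2; rewrite tsum3_tsum //.
apply: eq_tsum => x d; rewrite tsum3_tsum //.
by apply: eq_tsum => y d'; rewrite tsum3_pure.
Qed.

Lemma rho_counitC U (f : H -> U) c : lin f ->
  \tsum_(x, c0 <- rho c) counit wC c0 *: f x =
  \tsum_(x, c0 <- rho c) counit wC c0 *: f (T x).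
Proof.
move=> lf; have := congr1 f (cc_counit rho_bialg.1 c).
rewrite !(map_tsum _ _ lf) => E.
transitivity (\tsum_(x, c0 <- rho c) f (counit wC c0 *: x)).
  by apply: eq_tsum => x y; rewrite linZ.
by rewrite E; apply: eq_tsum => x y; rewrite linZ.
Qed.

Lemma rho_mul U (F : H -> C -> U) c d : bilin F ->
  \tsum_(x, c0 <- rho (c ⋆ d)) F x c0 =
  \tsum_(x, c0 <- rho c) \tsum_(y, d0 <- rho d) F (x ∙ y) (c0 ⋆ d0).
Proof.
move=> bF; rewrite (ca_mul rho_bialg.2) tsum_tsum //; apply: eq_tsum => x y.
by rewrite tsum_tsum //; apply: eq_tsum => x' y'; rewrite tsum_tens.
Qed.

Lemma rho_unit U (F : H -> C -> U) : bilin F ->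
  \tsum_(x, c0 <- rho (aone wC)) F x c0 =
  \tsum_(x, c0 <- rho (aone wC)) F (Q x) c0.
Proof.
move=> bF; rewrite {1}(ca_unit rho_bialg.2) tsum_tsum //.
by apply: eq_tsum => x y; rewrite tsum_tens.
Qed.

(** The idempotence of the projection c ⊗ h |-> c × h. *)
Lemma rho_coassoc_T U (f : C -> H -> U) c h : bilin f ->
  \tsum_(x, c0 <- rho c) \tsum_(y, d <- rho c0) f d (T y ∙ (T x ∙ h)) =
  \tsum_(x, c0 <- rho c) f c0 (T x ∙ h).
Proof.
move=> bf; sw rho_coassoc; swr amulA; swr (amulC (T _) (T _)).
by sw (eps_t_comul amulC (f := fun z => f _ (z ∙ h))).
Qed.

(** By the compatibility of rho with the coproduct, the left-hand side has
    T(x y_1) y_2 for x from rho c_1 and y from rho c_2, and this is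
    T(x) T(y_1) y_2 = T(x) y. *)
Lemma rho_comul_T U (F : C -> H -> C -> U) c : trilin F ->
  \tsum_(x, c0 <- rho c) \tsum_(c1, c2 <- comul wC c0)
    \tsum_(y, d <- rho c2) F c1 (T x ∙ y) d =
  \tsum_(c1, c2 <- comul wC c) \tsum_(x, d <- rho c1) \tsum_(y, d' <- rho c2)
     F d (T x ∙ y) d'.
Proof.
move=> tF; sw rho_comul; sw rho_coassoc.
swr (eps_t_mul amulC); swrl amulA.
by sw (eps_t_mul_comul (f := fun z => F _ (_ ∙ z) _)).
Qed.

(** * Generators of the cross product *)

(** ε(x h_1) h_2 = h T(x). *)
Lemma cross_tensE c h :
  cross_tens wH rho c h = \tsum_(x, c0 <- rho c) c0 ⊗ (T x ∙ h).
Proof.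
rewrite /cross_tens; swr amulC; sw (counit_comul_t (f := fun z => _ ⊗ z)).
by swr amulC.
Qed.

Lemma bilin_cross_tens : bilin (cross_tens wH rho).
Proof. by rewrite /cross_tens; lin. Qed.

Lemma cross_tens_T c h :
  \tsum_(x, c0 <- rho c) cross_tens wH rho c0 (T x ∙ h) = cross_tens wH rho c h.
Proof.
swr cross_tensE; rewrite cross_tensE.
by sw (rho_coassoc_T (f := fun d z => d ⊗ z)).
Qed.

Local Notation X := (cross_space wH rho).
Local Notation cr := (cross wH rho).
Local Notation incl := (@cross_incl k H C wH rho).

Lemma lin_incl : lin incl.
Proof. by move=> a x y; rewrite /cross_incl; apply: linearP. Qed.

Lemma incl_inj : injective incl.
Proof. exact: val_inj. Qed.

Lemma bilin_cross : bilin cr.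
Proof.
have [l r] := bilin_cross_tens.
by split=> u a x y; apply: incl_inj; rewrite lin_incl; [apply: l | apply: r].
Qed.

Lemma lin_crossl V (f : V -> C) h : lin f -> lin (fun x => cr (f x) h).
Proof. exact: (lin_comp (bilin_cross.1 h)). Qed.

Lemma lin_crossr V (f : V -> H) c : lin f -> lin (fun x => cr c (f x)).
Proof. exact: (lin_comp (bilin_cross.2 c)). Qed.

Ltac lin_user ::=
  first [simple apply lin_eps_t; lin | simple apply lin_eps_s; lin
  | simple apply lin_crossl; lin | simple apply lin_crossr; lin].

Lemma cross_T U (f : X -> U) c h : lin f ->
  \tsum_(x, c0 <- rho c) f (cr c0 (T x ∙ h)) = f (cr c h).
Proof.
move=> lf; rewrite -(map_tsum _ _ lf); congr (f _); apply: incl_inj.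
by rewrite (map_tsum _ _ (@lin_incl)); exact: cross_tens_T.
Qed.

(** Expanding both sides by cross_T, they differ by the extra factor T(x') on
    the left, for x' from the second coaction on c; this factor is absorbed by
    rho_coassoc_T. *)
Lemma cross_mul_T U (f : X -> U) c b h : lin f ->
  \tsum_(x, c0 <- rho c) f (cr (c0 ⋆ b) (T x ∙ h)) = f (cr (c ⋆ b) h).
Proof.
move=> lf; swl cross_T; sw rho_mul.
swr (eps_t_mul amulC); swrl amulA; swr (amulCA amulC).
sw (rho_coassoc_T (f := fun z w =>
  \tsum_(y, b0 <- rho b) f (cr (z ⋆ b0) (T y ∙ w)))).
swr (amulCA amulC); swr amulA; swrl (eps_t_mul amulC).
swl (rho_mul (F := fun z w => f (cr w (T z ∙ h)))).
exact: cross_T.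
Qed.

Lemma cross_mul_T' U (f : X -> U) c b h : lin f ->
  \tsum_(x, c0 <- rho c) f (cr (b ⋆ c0) (T x ∙ h)) = f (cr (b ⋆ c) h).
Proof.
move=> lf; swl cross_T; sw rho_mul.
sw exch_tsum at 1.
swr (eps_t_mul amulC); swrl amulA.
sw (rho_coassoc_T (f := fun z w =>
  \tsum_(y, b0 <- rho b) f (cr (b0 ⋆ z) (T y ∙ w)))).
sw exch_tsum; swr amulA; swrl (eps_t_mul amulC).
swl (rho_mul (F := fun z w => f (cr w (T z ∙ h)))).
exact: cross_T.
Qed.

(** The restriction to the cross product of the linear map on C ⊗ H that is
    induced by f. *)
Definition xlift U (f : C -> H -> U) (t : X) : U := \tsum_(c, h <- incl t) f c h.

Lemma lin_xlift U (f : C -> H -> U) : bilin f -> lin (xlift f).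
Proof. by move=> bf; apply: lin_tsum_arg (@lin_incl). Qed.

Lemma xlift_cross U (f : C -> H -> U) c h : bilin f ->
  xlift f (cr c h) = \tsum_(x, c0 <- rho c) f c0 (T x ∙ h).
Proof.
move=> bf; rewrite /xlift [incl _]cross_tensE tsum_tsum //.
by apply: eq_tsum => x c0; rewrite tsum_tens.
Qed.

Lemma cross_ext U (f g : X -> U) : lin f -> lin g ->
  (forall c h, f (cr c h) = g (cr c h)) -> f =1 g.
Proof.
move=> lf lg fg [t /[dup] /asboolP[n [a [v [crv tE]]]] tX].
have vX i : v i \in Defs.span (is_cross wH rho) by exact: mem_span.
pose w i : X := exist _ (v i) (vX i).
have -> : exist _ t tX = \sum_(i < n) a i *: w i :> X.
  by apply: incl_inj; rewrite (lin_sum _ _ (@lin_incl)).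
rewrite !lin_sum //; apply: eq_bigr => i _; congr (_ *: _).
have [c [h vE]] := crv i.
have -> : w i = cr c h by apply: val_inj.
exact: fg.
Qed.

(** * Product, coproduct, counit and antipode on generators *)

Definition mulX_fun (t u : X) : X :=
  xlift (fun c h => xlift (fun b g => cr (c ⋆ b) (h ∙ g)) u) t.

Lemma bilin_mulX : bilin mulX_fun.
Proof.
split=> u; rewrite /mulX_fun.
  by apply: lin_xlift; rewrite /xlift; lin.
rewrite /xlift; apply: lin_tsum => c h.
by apply: (@lin_xlift _ (fun b g => cr (c ⋆ b) (h ∙ g))); lin.
Qed.

Definition mulX : {bilinear X -> X -> X} := bilinear_of bilin_mulX.

Definition comulX_fun : X -> tensor X X := xlift (fun c h =>
  \tsum_(c1, c2 <- comul wC c) \tsum_(x, c0 <- rho c2)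
    \tsum_(h1, h2 <- comul wH h) cr c1 (x ∙ h1) ⊗ cr c0 h2).

Lemma lin_comulX : lin comulX_fun.
Proof. by apply: lin_xlift; lin. Qed.

Definition comulX : {linear X -> tensor X X} := linear_of (@lin_comulX).

(** Scaling of 1 in the regular module takes the place of a product of
    scalars, so that the summand is a composite of module operations. *)
Definition counitX_fun : X -> k^o := xlift (fun c h =>
  \tsum_(x, c0 <- rho c) counit wC c0 *: (counit wH (x ∙ h) *: (1 : k^o))).

Lemma lin_counitX : lin counitX_fun.
Proof. by apply: lin_xlift; lin. Qed.

Definition counitX : {scalar X} := scalar_of (@lin_counitX).

Definition antipodeX_fun : X -> X := xlift (fun c h =>
  \tsum_(x, c0 <- rho c) cr (antipode wC c0) (S (x ∙ h))).

Lemma lin_antipodeX : lin antipodeX_fun.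
Proof. by apply: lin_xlift; lin. Qed.

Definition antipodeX : {linear X -> X} := linear_of (@lin_antipodeX).

Lemma mulX_cross c h b g : mulX (cr c h) (cr b g) = cr (c ⋆ b) (h ∙ g).
Proof.
rewrite [LHS](xlift_cross (f := fun c h => xlift _ _)); last first.
  by rewrite /xlift; lin.
transitivity (\tsum_(x, c0 <- rho c) cr (c0 ⋆ b) (T x ∙ (h ∙ g))); last first.
  exact: (cross_mul_T (f := fun z => z)).
apply: eq_tsum => x c0; rewrite xlift_cross; last by lin.
swr (amulCA amulC); sw (cross_mul_T' (f := fun z => z)); by rewrite amulA.
Qed.

(** Applying the coproduct of C ⊗ H to a projected element amounts to
    projecting the first factor of the coproduct. *)
Lemma rho_comul_cross U (F : C -> H -> C -> H -> U) c h : quadlin F ->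
  \tsum_(x, c0 <- rho c) \tsum_(c1, c2 <- comul wC c0) \tsum_(y, d <- rho c2)
    \tsum_(h1, h2 <- comul wH (T x ∙ h)) F c1 (y ∙ h1) d h2 =
  \tsum_(c1, c2 <- comul wC c) \tsum_(y, d <- rho c2)
    \tsum_(h1, h2 <- comul wH h)
      \tsum_(x, c0 <- rho c1) F c0 (T x ∙ (y ∙ h1)) d h2.
Proof.
move=> qF; sw comul_eps_t_mul; swr (amulCA amulC); swr amulA.
sw (rho_comul_T (F := fun c1 z d =>
  \tsum_(h1, h2 <- comul wH h) F c1 (z ∙ h1) d h2)).
by swrl amulA; sw exch_tsum at 1; sw exch_tsum at 2.
Qed.

Lemma comulX_cross U (F : X -> X -> U) c h : bilin F ->
  \tsum_(u, v <- comulX (cr c h)) F u v =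
  \tsum_(c1, c2 <- comul wC c) \tsum_(x, c0 <- rho c2)
    \tsum_(h1, h2 <- comul wH h) F (cr c1 (x ∙ h1)) (cr c0 h2).
Proof.
move=> bF; rewrite [comulX _]xlift_cross; last by lin.
sw tsum_tsum; sw tsum_tsum; sw tsum_tsum; sw tsum_tsum; sw (tsum_tens (f := F)).
sw (rho_comul_cross (F := fun p q r s => F (cr p q) (cr r s))).
by sw (cross_T (f := fun z => F z _)).
Qed.

Lemma comulX_crossE c h : comulX (cr c h) =
  \tsum_(c1, c2 <- comul wC c) \tsum_(x, c0 <- rho c2)
    \tsum_(h1, h2 <- comul wH h) cr c1 (x ∙ h1) ⊗ cr c0 h2.
Proof. by rewrite -[LHS]tsum_tensK; apply: comulX_cross; lin. Qed.

Lemma scaleAC U (a a' : k) (v : U) : a *: (a' *: v) = a' *: (a *: v).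
Proof. by rewrite !scalerA mulrC. Qed.

Lemma counitX_cross c h : counitX (cr c h) =
  \tsum_(x, c0 <- rho c) (counit wC c0 * counit wH (x ∙ h)).
Proof.
have -> : counitX (cr c h) = \tsum_(x, c0 <- rho c)
    counit wC c0 *: (counit wH (x ∙ h) *: (1 : k^o)) :> k^o.
  rewrite [LHS]xlift_cross; last by lin.
  sw (rho_coassoc (U := k^o)); swr amulA; swr (amulC _ (T _)).
  by sw (eps_t_mul_comul (f := fun z => _ *: (counit wH (z ∙ h) *: (1 : k^o)))).
by apply: eq_bigr => z _; rewrite /GRing.scale /= mulr1.
Qed.

Lemma counitX_scale U (v : U) c h : counitX (cr c h) *: v =
  \tsum_(x, c0 <- rho c) counit wC c0 *: (counit wH (x ∙ h) *: v).
Proof.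
rewrite counitX_cross /tlift scaler_suml; apply: eq_bigr => z _.
by rewrite scalerA.
Qed.

Lemma antipodeX_cross c h : antipodeX (cr c h) =
  \tsum_(x, c0 <- rho c) cr (antipode wC c0) (S (x ∙ h)).
Proof.
rewrite [LHS]xlift_cross; last by lin.
sw rho_coassoc; swr amulA; swr (amulC _ (T _)).
by sw (eps_t_mul_comul (f := fun z => cr _ (S (z ∙ h)))).
Qed.

Definition oneX : X := cr (aone wC) (aone wH).

(** * The weak bialgebra axioms *)

Lemma mulX_assoc : associative mulX.
Proof.
move=> t u v.
apply: (cross_ext (f := fun t => mulX t _) (g := fun t => mulX (mulX t u) v)) t;
  [by lin | by lin | move=> c h].
apply: (cross_ext (f := fun u => mulX _ (mulX u _))
  (g := fun u => mulX (mulX _ u) v)) u; [by lin | by lin | move=> b g].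
apply: (cross_ext (f := fun v => mulX _ (mulX _ v))
  (g := fun v => mulX _ v)) v; [by lin | by lin | move=> d l].
by rewrite !mulX_cross !amulA.
Qed.

Lemma mul1X : left_id oneX mulX.
Proof.
move=> t; apply: (cross_ext (g := fun t => t)) t => [||c h]; try by lin.
by rewrite mulX_cross !amul1x.
Qed.

Lemma mulX1 : right_id oneX mulX.
Proof.
move=> t; apply: (cross_ext (f := fun t => mulX t _) (g := fun t => t)) t =>
  [||c h]; try by lin.
by rewrite mulX_cross !amulx1.
Qed.

Definition algebraX : algebra X := Algebra (@mulX_assoc) (@mul1X) (@mulX1).

(** A form of the iterated coproduct in which the two coactions on c_23 are
    separate coactions on c_2 and c_3; the other bracketing is reduced to it
    in comulX_coassoc. *)
Lemma comulX2_cross U (F : X -> X -> X -> U) c h : trilin F ->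
  \tsum_(u, v <- comulX (cr c h)) \tsum_(v1, v2 <- comulX v) F u v1 v2 =
  \tsum_(c1, c23 <- comul wC c) \tsum_(c2, c3 <- comul wC c23)
    \tsum_(x, d2 <- rho c2) \tsum_(y, d3 <- rho c3)
    \tsum_(y1, y2 <- comul wH y)
    \tsum_(h1, h23 <- comul wH h) \tsum_(h2, h3 <- comul wH h23)
      F (cr c1 (x ∙ y1 ∙ h1)) (cr d2 (y2 ∙ h2)) (cr d3 h3).
Proof.
move=> tF; sw comulX_cross; sw comulX_cross.
sw exch_tsum at 2; sw rho_comul at 1.
by sw exch_tsum at 4; sw rho_coassoc at 3.
Qed.

Lemma comulX_coassoc U (F : X -> X -> X -> U) t : trilin F ->
  \tsum_(u, v <- comulX t) \tsum_(u1, u2 <- comulX u) F u1 u2 v =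
  \tsum_(u, v <- comulX t) \tsum_(v1, v2 <- comulX v) F u v1 v2.
Proof.
move=> tF.
apply: (cross_ext (f := fun t => \tsum_(u, v <- comulX t) _)
  (g := fun t => \tsum_(u, v <- comulX t) _)) t;
  [by lin | by lin | move=> c h].
symmetry; sw comulX2_cross; symmetry; sw comulX_cross; sw comulX_cross.
sw comul_mul at 5.
sw exch_tsum at 2; sw exch_tsum at 1; sw coassoc.
sw exch_tsum at 3; sw exch_tsum at 2; sw exch_tsum at 4; sw coassoc at 5.
by swr amulA.
Qed.

(** The coactions on c_1 and c_2 combine into one coaction on c, after which
    the counits of C and H apply in turn. *)
Lemma counitX_l t : \tsum_(u, v <- comulX t) counitX u *: v = t.
Proof.
apply: (cross_ext (f := fun t => \tsum_(u, v <- comulX t) _) (g := fun t => t)) t;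
  [by lin | by lin | move=> c h].
sw comulX_cross; sw counitX_scale.
sw exch_tsum at 2; sw exch_tsum at 1; swr amulA.
swl (rho_comul (F := fun x d d' =>
   \tsum_(h1, h2 <- comul wH h) counit wC d *: (counit wH (x ∙ h1) *: cr d' h2))).
sw exch_tsum at 1.
sw (counit_l (f := fun z => counit wH (_ ∙ _) *: cr z _)).
swr amulC; sw (counit_comul_t (f := fun z => cr _ z)).
by swr amulC; sw (cross_T (f := fun z => z)).
Qed.

(** This leaves ε(c_2) in front of a coaction on c_2, where rho_counitC inserts
    T; the result is the coaction on all of c followed by T. *)
Lemma counitX_r t : \tsum_(u, v <- comulX t) counitX v *: u = t.
Proof.
apply: (cross_ext (f := fun t => \tsum_(u, v <- comulX t) _) (g := fun t => t)) t;
  [by lin | by lin | move=> c h].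
sw comulX_cross; sw counitX_scale.
sw exch_tsum at 2; sw rho_coassoc at 1.
swl (comul_mul (F := fun x y => counit wC _ *: (counit wH y *: cr _ x))) at 2.
swr scaleAC; sw (counit_r (f := fun a => counit wC _ *: cr _ a)).
sw (rho_counitC (f := fun z => cr _ (z ∙ _))).
swl (cross_T (f := fun z => counit wC _ *: z)).
sw exch_tsum at 1; swr amulA; swrl (eps_t_mul amulC).
swl (rho_comul (F := fun z d d' => counit wC d' *: cr d (T z ∙ h))).
sw (counit_r (f := fun z => cr z _)).
exact: (cross_T (f := fun z => z)).
Qed.

Lemma comulX_mul t u :
  comulX (mulX t u) = tens_mul mulX mulX (comulX t) (comulX u).
Proof.
rewrite /tens_mul.
apply: (cross_ext (f := fun t => comulX (mulX t u)) (g := fun t =>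
  \tsum_(a, b <- comulX t) _)) t;
  [by lin | by lin | move=> c h].
apply: (cross_ext (f := fun u => comulX (mulX _ u)) (g := fun u =>
  \tsum_(a, b <- _) \tsum_(a', b' <- comulX u) _)) u;
  [by lin | by lin | move=> b g].
symmetry; sw comulX_cross; sw comulX_cross; swr mulX_cross; swr mulX_cross.
symmetry; rewrite mulX_cross comulX_crossE.
sw comul_mul; sw rho_mul; sw comul_mul; swr (amulACA amulC).
by sw exch_tsum at 1; sw exch_tsum at 3; sw exch_tsum at 2.
Qed.

(** Coassociativity of rho and the multiplicativity of the coproduct bring the
    two counits of H into the form ε(p u_1) ε(u_2 q), with u the product of an
    element from rho b_2 with g. After the axiom for H, the coactions on b_1
    and b_2 combine, and the axiom for C applies. *)
Lemma counitX12 U (v : U) t m w :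
  \tsum_(m1, m2 <- comulX m)
    counitX (mulX t m1) *: (counitX (mulX m2 w) *: v) =
  counitX (mulX (mulX t m) w) *: v.
Proof.
apply: (cross_ext (f := fun t => \tsum_(m1, m2 <- _) _)
  (g := fun t => counitX (mulX (mulX t m) w) *: v)) t;
  [by lin | by lin | move=> c h].
apply: (cross_ext (f := fun m => \tsum_(m1, m2 <- comulX m) _)
  (g := fun m => counitX (mulX (mulX _ m) w) *: v)) m;
  [by lin | by lin | move=> b g].
apply: (cross_ext (f := fun w => \tsum_(m1, m2 <- _) _)
  (g := fun w => counitX (mulX _ w) *: v)) w; [by lin | by lin | move=> d l].
have ac1 x y z p q : x ∙ y ∙ (z ∙ (p ∙ q)) = x ∙ y ∙ z ∙ (p ∙ q).
  by rewrite !amulA.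
have ac2 x y z p q r s : x ∙ y ∙ z ∙ (p ∙ q) ∙ (r ∙ s) =
    x ∙ (y ∙ p) ∙ r ∙ (z ∙ q ∙ s).
  rewrite [X in X ∙ _](amulACA amulC) [LHS](amulACA amulC).
  by rewrite -[x ∙ y ∙ p]amulA.
sw comulX_cross; swr mulX_cross; swr mulX_cross.
sw counitX_scale; sw rho_mul.
swr counitX_scale; swr scale_tsum; swr scale_tsum; sw rho_mul.
sw exch_tsum at 4; sw exch_tsum at 3; sw exch_tsum at 2; sw rho_coassoc at 1.
swr ac1.
sweedler ltac:(rewrite [in X in _ *: (_ *: X)](amulACA amulC); reflexivity).
sweedler ltac:(rewrite [X in _ *: X]scaleAC; reflexivity).
sweedler ltac:(rewrite [LHS]scalerA; reflexivity).
swl (comul_mul (F := fun x y =>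
  \tsum_(z, c0 <- rho c) \tsum_(p, b1 <- rho _) \tsum_(r, d0 <- rho d)
    (counit wC (c0 ⋆ b1) * counit wC (_ ⋆ d0)) *:
      (counit wH (z ∙ p ∙ h ∙ x) *: (counit wH (y ∙ (r ∙ l)) *: v)))).
sw exch_tsum at 2; sw exch_tsum at 3; sw exch_tsum at 4.
swl scale_tsum; swr counit12; swrl scalerA; swr ac2.
sw exch_tsum at 2; sw exch_tsum at 1.
swl (rho_comul (F := fun x d1 d2 => \tsum_(z, c0 <- rho c)
  \tsum_(r, d0 <- rho d) counit wC (c0 ⋆ d1) *: (counit wC (d2 ⋆ d0) *:
    (counit wH (z ∙ x ∙ r ∙ (h ∙ g ∙ l)) *: v)))).
sw exch_tsum at 1; sw exch_tsum at 2; sw counit12.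
sw exch_tsum; symmetry; rewrite !mulX_cross.
by sw counitX_scale; sw rho_mul; sw rho_mul.
Qed.

Lemma counitX21 U (v : U) t m w :
  \tsum_(m1, m2 <- comulX m)
    counitX (mulX t m2) *: (counitX (mulX m1 w) *: v) =
  counitX (mulX (mulX t m) w) *: v.
Proof.
apply: (cross_ext (f := fun t => \tsum_(m1, m2 <- _) _)
  (g := fun t => counitX (mulX (mulX t m) w) *: v)) t;
  [by lin | by lin | move=> c h].
apply: (cross_ext (f := fun m => \tsum_(m1, m2 <- comulX m) _)
  (g := fun m => counitX (mulX (mulX _ m) w) *: v)) m;
  [by lin | by lin | move=> b g].
apply: (cross_ext (f := fun w => \tsum_(m1, m2 <- _) _)
  (g := fun w => counitX (mulX _ w) *: v)) w; [by lin | by lin | move=> d l].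
have ac x y z p q r : x ∙ h ∙ (y ∙ z) ∙ (p ∙ q ∙ r) =
    x ∙ (p ∙ y) ∙ q ∙ (h ∙ z ∙ r).
  rewrite [x ∙ h ∙ _](amulACA amulC) [LHS](amulACA amulC) [p ∙ y]amulC.
  by rewrite -[RHS](amulA _) !(amulA _ x) -!(amulA _ (x ∙ y)) !amulA.
sw comulX_cross; swr mulX_cross; swr mulX_cross.
sw counitX_scale; sw rho_mul.
swr counitX_scale; swr scale_tsum; swr scale_tsum; sw rho_mul.
sw exch_tsum at 3; sw exch_tsum at 2; sw rho_coassoc at 1.
sweedler ltac:(rewrite [in X in _ *: (X *: _)](amulACA amulC); reflexivity).
sweedler ltac:(rewrite [in X in _ *: (_ *: (_ *: X))](amulCA amulC); reflexivity).
sweedler ltac:(rewrite [X in _ *: X]scaleAC; reflexivity).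
sweedler ltac:(rewrite [LHS]scalerA; reflexivity).
swl (comul_mul (F := fun x y =>
  \tsum_(z, c0 <- rho c) \tsum_(p, b1 <- rho _) \tsum_(r, d0 <- rho d)
    (counit wC (c0 ⋆ _) * counit wC (b1 ⋆ d0)) *:
      (counit wH (z ∙ h ∙ y) *: (counit wH (x ∙ (p ∙ r ∙ l)) *: v)))).
sw exch_tsum at 2; sw exch_tsum at 3; sw exch_tsum at 4.
swl scale_tsum; swr counit21; swrl scalerA; swr ac.
sw exch_tsum at 2; sw exch_tsum at 1.
swl (rho_comul (F := fun x d1 d2 => \tsum_(z, c0 <- rho c)
  \tsum_(r, d0 <- rho d) counit wC (c0 ⋆ d2) *: (counit wC (d1 ⋆ d0) *:
    (counit wH (z ∙ x ∙ r ∙ (h ∙ g ∙ l)) *: v)))).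
sw exch_tsum at 1; sw exch_tsum at 2; sw counit21.
sw exch_tsum; symmetry; rewrite !mulX_cross.
by sw counitX_scale; sw rho_mul; sw rho_mul.
Qed.

(** Here op is the product of C or its opposite, which gives both expressions
    for the iterated coproduct of the unit. *)
Lemma comulX_unit U (F : X -> X -> X -> U) (op : C -> C -> C) : trilin F ->
  bilin op ->
  (forall V (G : C -> C -> C -> V), trilin G ->
    \tsum_(i, j <- comul wC (aone wC)) \tsum_(j1, j2 <- comul wC j) G i j1 j2 =
    \tsum_(i, j <- comul wC (aone wC)) \tsum_(i', j' <- comul wC (aone wC))
       G i (op i' j) j') ->
  (forall V (G : H -> C -> V) c d, bilin G ->
    \tsum_(x, d0 <- rho (op c d)) G x d0 =
    \tsum_(x, c0 <- rho c) \tsum_(y, d0 <- rho d) G (x ∙ y) (op c0 d0)) ->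
  (forall V (f : X -> V) c d h, lin f ->
    \tsum_(x, c0 <- rho c) f (cr (op c0 d) (T x ∙ h)) = f (cr (op c d) h)) ->
  \tsum_(u, v <- comulX oneX) \tsum_(v1, v2 <- comulX v) F u v1 v2 =
  \tsum_(i, i2 <- comul wC (aone wC)) \tsum_(x, i0 <- rho i2)
  \tsum_(a, b <- comul wH (aone wH))
  \tsum_(j, j2 <- comul wC (aone wC)) \tsum_(y, j0 <- rho j2)
  \tsum_(a', b' <- comul wH (aone wH))
    F (cr i (x ∙ a)) (cr (op j i0) (y ∙ a' ∙ b)) (cr j0 b').
Proof.
move=> tF bop opU op_rho opT; rewrite comulX2_cross //.
sw opU; sw op_rho.
swl rho_coassoc at 4.
sw comul_unit_l.
have ac x y z t : x ∙ y ∙ z ∙ t = y ∙ (x ∙ z ∙ t).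
  by rewrite [x ∙ y]amulC -!amulA.
swr ac; sw exch_tsum at 3.
swl (rho_comul (F := fun z c0 d => \tsum_(y, d0 <- rho _)
  \tsum_(q, d3 <- rho d) \tsum_(a, b <- comul wH (aone wH))
  \tsum_(a', b' <- comul wH (aone wH))
    F (cr _ (y ∙ (z ∙ a))) (cr (op c0 d0) (q ∙ (a' ∙ b))) (cr d3 b'))).
(* The coaction on the unit of C has values in H_s ⊗ C, so its first factor
   moves across the coproduct of the unit of H. *)
sw rho_unit.
sw (unit_eps_s amulC (F := fun a b =>
  \tsum_(a', b' <- comul wH (aone wH))
    F (cr _ (_ ∙ a)) (cr _ (_ ∙ (a' ∙ b))) (cr _ b'))).
swl (rho_unit (F := fun z j => \tsum_(c0, d <- comul wC j)
  \tsum_(y, d0 <- rho _) \tsum_(q, d3 <- rho d)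
  \tsum_(a, b <- comul wH (aone wH)) \tsum_(a', b' <- comul wH (aone wH))
    F (cr _ (y ∙ a)) (cr (op c0 d0) (q ∙ (a' ∙ (T z ∙ b)))) (cr d3 b'))).
have ac' x y z t : x ∙ (y ∙ (T z ∙ t)) = T z ∙ x ∙ (y ∙ t).
  by rewrite [y ∙ _](amulCA amulC) [LHS](amulCA amulC) amulA.
swr ac'; sw exch_tsum at 3.
sw (rho_comul_T (F := fun c1 z d => \tsum_(y, d0 <- rho _)
  \tsum_(a, b <- comul wH (aone wH)) \tsum_(a', b' <- comul wH (aone wH))
    F (cr _ (y ∙ a)) (cr (op c1 d0) (z ∙ (a' ∙ b))) (cr d b'))).
sw exch_tsum at 2; sw exch_tsum at 3; sw exch_tsum at 4; sw exch_tsum at 5.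
have ac'' x y z : T z ∙ x ∙ y = T z ∙ (x ∙ y) by rewrite amulA.
swr ac''.
(* The coaction on j, with T applied, is now the relation between generators. *)
sw (opT _ (fun u => F _ u _)).
by sw exch_tsum at 2; sw exch_tsum at 1; sw exch_tsum at 3; sw exch_tsum at 2;
   swr amulA.
Qed.

Lemma comulX_unit_l U (F : X -> X -> X -> U) : trilin F ->
  \tsum_(u, v <- comulX oneX) \tsum_(v1, v2 <- comulX v) F u v1 v2 =
  \tsum_(u, v <- comulX oneX) \tsum_(u', v' <- comulX oneX) F u (mulX u' v) v'.
Proof.
move=> tF; symmetry; sw comulX_cross; sw comulX_cross; swr mulX_cross.
symmetry; apply: (comulX_unit (op := fun c d => c ⋆ d)) => //.
- by lin.
- by move=> V G tG; exact: comul_unit_l.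
- by move=> V G c d; exact: rho_mul.
- by move=> V f c d h; exact: cross_mul_T.
Qed.

Lemma comulX_unit_r U (F : X -> X -> X -> U) : trilin F ->
  \tsum_(u, v <- comulX oneX) \tsum_(v1, v2 <- comulX v) F u v1 v2 =
  \tsum_(u, v <- comulX oneX) \tsum_(u', v' <- comulX oneX) F u (mulX v u') v'.
Proof.
have ac x y z : x ∙ (y ∙ z) = y ∙ z ∙ x by rewrite amulC.
move=> tF; symmetry; sw comulX_cross; sw comulX_cross; swr mulX_cross; swr ac.
symmetry; apply: (comulX_unit (op := fun c d => d ⋆ c)) => //.
- by lin.
- by move=> V G tG; exact: comul_unit_r.
- by move=> V G c d bG; sw rho_mul; sw exch_tsum; swr amulC.
- by move=> V f c d h; exact: cross_mul_T'.
Qed.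

(** * The antipode axioms *)

Definition eps_tX (t : X) : X :=
  \tsum_(u, v <- comulX oneX) counitX (mulX u t) *: v.

Definition eps_sX (t : X) : X :=
  \tsum_(u, v <- comulX oneX) counitX (mulX t v) *: u.

Lemma lin_eps_tX V (f : V -> X) : lin f -> lin (fun x => eps_tX (f x)).
Proof. by move=> lf; rewrite /eps_tX; lin. Qed.

Lemma lin_eps_sX V (f : V -> X) : lin f -> lin (fun x => eps_sX (f x)).
Proof. by move=> lf; rewrite /eps_sX; lin. Qed.

Ltac lin_user ::=
  first [simple apply lin_eps_t; lin | simple apply lin_eps_s; lin
  | simple apply lin_crossl; lin | simple apply lin_crossr; lin
  | simple apply lin_eps_tX; lin | simple apply lin_eps_sX; lin].

(** The coactions on the two factors of the coproduct of 1_C combine, and the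
    sum over the coproduct in C becomes a product with eps_t(c0); the coaction
    on 1_C that remains is absorbed by cross_mul_T. *)
Lemma eps_tX_cross c h :
  eps_tX (cr c h) = \tsum_(x, c0 <- rho c) cr (eps_t wC c0) (T x ∙ T h).
Proof.
rewrite /eps_tX; sw comulX_cross; swr mulX_cross; sw counitX_scale; sw rho_mul.
have ac x y z p q : x ∙ y ∙ (z ∙ p ∙ q) = p ∙ (x ∙ z ∙ (y ∙ q)).
  rewrite [z ∙ p]amulC -[p ∙ z ∙ q]amulA.
  by rewrite [LHS](amulCA amulC) (amulACA amulC).
swr ac; sw exch_tsum at 2; sw exch_tsum at 1.
swl (rho_comul (F := fun z w d =>
  \tsum_(a, b <- comul wH (aone wH)) \tsum_(x, c0 <- rho c)
    counit wC (w ⋆ c0) *: (counit wH (a ∙ (z ∙ (x ∙ h))) *: cr d b))).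
sw exch_tsum at 1; sw exch_tsum at 2.
sw (counit_comul_t (f := fun d => counit wH _ *: cr d _)).
sw exch_tsum at 1; swl (map_eps_t (f := fun z => cr _ z)).
sw exch_tsum; swr (eps_t_mul amulC); sw (cross_mul_T (f := fun z => z)).
by swr amul1x; swr (eps_t_mul amulC).
Qed.

(** The coproduct in H yields T(x h), for x from rho c_2. A coaction on c_1 is
    created by cross_mul_T, so that it can combine with the one on c_2; then
    the antipode axiom of C applies. *)
Lemma antipodeX_t t :
  \tsum_(u, v <- comulX t) mulX u (antipodeX v) = eps_tX t.
Proof.
apply: (cross_ext (f := fun t => \tsum_(u, v <- comulX t) _)) t => [||c h];
  [by lin | by lin | ].
rewrite eps_tX_cross.
sw comulX_cross; swr antipodeX_cross; sw (map_tsum (g := fun z => mulX _ z)).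
swr mulX_cross; sw exch_tsum at 2; sw rho_coassoc at 1.
swl (comul_mul (F := fun p q => cr _ (p ∙ S q))).
sw (map_antipode_t (f := fun z => cr _ z)).
swl (cross_mul_T (f := fun z => z)).
swrl (eps_t_mul amulC); swr amulA; sw exch_tsum at 1.
swl (rho_comul (F := fun z d d' => cr (d ⋆ antipode wC d') (T (z ∙ h)))).
sw (map_antipode_t (f := fun w => cr w _)).
by swr (eps_t_mul amulC).
Qed.

(** A direct evaluation produces Q(x) where S(x) is required, for x from
    rho c. Writing Q(x) = S(x_1) x_2, the factor x_2 combines with the coaction
    on 1_2 to the coaction on c0 1_2, on which ε_C permits the insertion of T;
    then S(x_1) T(x_2) = S(x) removes it. *)
Lemma eps_sX_cross c h :
  eps_sX (cr c h) = \tsum_(x, c0 <- rho c) cr (eps_s wC c0) (S x ∙ Q h).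
Proof.
rewrite /eps_sX; sw comulX_cross; swr mulX_cross; sw counitX_scale; sw rho_mul.
sw exch_tsum at 3; sw exch_tsum at 2; sw rho_coassoc at 1; swr (amulACA amulC).
swl (comul_mul (F := fun p q => \tsum_(x, c0 <- rho c)
  counit wC (c0 ⋆ _) *: (counit wH (x ∙ h ∙ q) *: cr _ p))).
sw exch_tsum at 2; swr scaleAC.
sw (counit_comul_s (f := fun z => counit wC _ *: cr _ z)).
swr amulx1; swr (eps_s_mul amulC).
swl (map_antipode_s (f := fun z => counit wC _ *: cr _ (z ∙ _ ∙ _))).
sw exch_tsum at 1; sw exch_tsum; sw exch_tsum at 2; sw exch_tsum at 1.
swl (rho_coassoc (F := fun x y d => \tsum_(i, i2 <- comul wC (aone wC))
  \tsum_(z, i0 <- rho i2)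
    counit wC (d ⋆ i0) *: cr i (S x ∙ y ∙ Q h ∙ z))).
have ac x y z t : x ∙ y ∙ z ∙ t = x ∙ z ∙ (y ∙ t).
  by rewrite [x ∙ y ∙ z](amulAC amulC) amulA.
swr ac; sw exch_tsum at 1.
(* Folding to a single coaction on a product in C, for rho_counitC. *)
swl (rho_mul (F := fun p d => counit wC d *: cr _ (S _ ∙ Q h ∙ p))).
sw (rho_counitC (f := fun p => cr _ (S _ ∙ Q h ∙ p))); sw rho_mul.
sw exch_tsum at 1; sw rho_coassoc.
swr (eps_t_mul amulC); swr (amulACA amulC).
sw exch_tsum at 1; sw exch_tsum at 2.
sw (antipode_mul_eps_t (f := fun z => counit wC _ *: cr _ (z ∙ _))).
swl (cross_T (f := fun z => counit wC _ *: z)).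
have ac' x y z t : x ∙ (y ∙ (z ∙ t)) = x ∙ t ∙ (y ∙ z).
  by rewrite [y ∙ _]amulA [y ∙ z ∙ t]amulC amulA.
swr ac'; swrl (eps_t_mul amulC); sw exch_tsum at 2.
swl (rho_comul (F := fun z d d' =>
  counit wC (_ ⋆ d') *: cr d (T z ∙ (S _ ∙ Q h)))).
sw (counit_comul_s (f := fun d => cr d _)).
sw (cross_mul_T' (f := fun z => z)).
by swr amulx1.
Qed.

Lemma antipodeX_s t :
  \tsum_(u, v <- comulX t) mulX (antipodeX u) v = eps_sX t.
Proof.
apply: (cross_ext (f := fun t => \tsum_(u, v <- comulX t) _)) t => [||c h];
  [by lin | by lin | ].
rewrite eps_sX_cross.
sw comulX_cross; swr antipodeX_cross; sw (map_tsum (g := fun z => mulX z _)).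
swr mulX_cross; swr amulA; swr (antipodeM amulC); swrl amulA.
sw exch_tsum at 2; sw (map_antipode_s (f := fun z => cr _ (_ ∙ z))).
sw exch_tsum at 1.
swl (rho_comul (F := fun z d d' => cr (antipode wC d ⋆ d') (S z ∙ Q h))).
by sw (map_antipode_s (f := fun w => cr w _)).
Qed.

(** The last two factors of S(t_1) t_2 S(t_3) are eps_t(t_2), known on
    generators. *)
Lemma antipodeX_K t :
  \tsum_(u, v <- comulX t) \tsum_(v1, v2 <- comulX v)
    mulX (mulX (antipodeX u) v1) (antipodeX v2) = antipodeX t.
Proof.
swrl mulX_assoc; swl (map_tsum (g := fun z => mulX _ z)); swr antipodeX_t.
apply: (cross_ext (f := fun t => \tsum_(u, v <- comulX t) _)) t => [||c h];
  [by lin | by lin | ].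
rewrite antipodeX_cross.
sw comulX_cross; swr antipodeX_cross; sw (map_tsum (g := fun z => mulX z _)).
swr eps_tX_cross; sw (map_tsum (g := fun z => mulX _ z)).
swr mulX_cross; swrl (eps_t_mul amulC).
sw exch_tsum at 3; sw exch_tsum at 2; sw rho_coassoc at 1.
swr (antipodeM amulC); swrl amulA.
swl (comul_mul (F := fun p q => \tsum_(z, w <- rho _)
  cr (antipode wC w ⋆ eps_t wC _) (S z ∙ (S p ∙ T q)))).
sw exch_tsum at 2; sw (antipode_mul_eps_t (f := fun z => cr _ (_ ∙ z))).
swrl (antipodeM amulC); swr amulA; sw exch_tsum at 1.
swl (rho_comul (F := fun z d d' =>
  cr (antipode wC d ⋆ eps_t wC d') (S (z ∙ h)))).
by sw (antipode_mul_eps_t (f := fun w => cr w _)).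
Qed.

Lemma comul2_comulX t : comul2 comulX t =
  \tsum_(u, v <- comulX t) \tsum_(v1, v2 <- comulX v) u ⊗ (v1 ⊗ v2).
Proof. by sw (comulX_coassoc (F := fun u v w => u ⊗ (v ⊗ w))). Qed.

Lemma comulX_assoc t :
  comul2 comulX t = \tsum_(u, v <- comulX t) u ⊗ comulX v.
Proof.
rewrite comul2_comulX; swl (map_tsum (g := fun z => _ ⊗ z)).
by swr tsum_tensK.
Qed.

Definition coalgebraX : coalgebra X :=
  Coalgebra (@comulX_assoc) (@counitX_l) (@counitX_r).

Lemma scale_scale1 (a a' : k) : a *: (a' *: (1 : k^o)) = a * a'.
Proof. by rewrite /GRing.scale /= mulr1. Qed.

Lemma counitX_mul12 t u v : counitX (mulX (mulX t u) v) =
  \tsum_(u1, u2 <- comulX u) (counitX (mulX t u1) * counitX (mulX u2 v)).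
Proof.
have := @counitX12 k^o 1 t u v; rewrite [RHS]mulr1 => <-.
by apply: eq_bigr => z _; exact: scale_scale1.
Qed.

Lemma counitX_mul21 t u v : counitX (mulX (mulX t u) v) =
  \tsum_(u1, u2 <- comulX u) (counitX (mulX t u2) * counitX (mulX u1 v)).
Proof.
have := @counitX21 k^o 1 t u v; rewrite [RHS]mulr1 => <-.
by apply: eq_bigr => z _; exact: scale_scale1.
Qed.

Lemma comulX1_l :
  tens_mul mulX (tens_mul mulX mulX) (oneX ⊗ comulX oneX)
    (\tsum_(u, v <- comulX oneX) u ⊗ (v ⊗ oneX)) = comul2 comulX oneX.
Proof.
by rewrite comul2_comulX comulX_unit_l; [exact: (unit_tens_mul_l algebraX) | lin].
Qed.

Lemma comulX1_r :
  tens_mul mulX (tens_mul mulX mulX)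
    (\tsum_(u, v <- comulX oneX) u ⊗ (v ⊗ oneX)) (oneX ⊗ comulX oneX)
  = comul2 comulX oneX.
Proof.
by rewrite comul2_comulX comulX_unit_r; [exact: (unit_tens_mul_r algebraX) | lin].
Qed.

Definition weak_bialgebraX : weak_bialgebra X :=
  @WeakBialgebra k X algebraX coalgebraX (@comulX_mul) (@counitX_mul12)
    (@counitX_mul21) comulX1_l comulX1_r.

Definition weak_hopfX : weak_hopf X :=
  @WeakHopf k X weak_bialgebraX antipodeX (@antipodeX_t) (@antipodeX_s)
    (@antipodeX_K).

(** * The cross product inside the tensor product *)

Lemma lin_incl_comp V (f : V -> X) : lin f -> lin (fun x => incl (f x)).
Proof. exact: (lin_comp (@lin_incl)). Qed.

Lemma lin_cross_tensr V (f : V -> H) c :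
  lin f -> lin (fun x => cross_tens wH rho c (f x)).
Proof. exact: (lin_comp (bilin_cross_tens.2 c)). Qed.

Lemma lin_cross_tensl V (f : V -> C) h :
  lin f -> lin (fun x => cross_tens wH rho (f x) h).
Proof. exact: (lin_comp (bilin_cross_tens.1 h)). Qed.

Ltac lin_user ::=
  first [simple apply lin_eps_t; lin
  | simple apply lin_crossl; lin | simple apply lin_crossr; lin
  | simple apply lin_cross_tensl; lin | simple apply lin_cross_tensr; lin
  | simple apply lin_incl_comp; lin].

Lemma incl_cross c h :
  incl (cr c h) = \tsum_(x, c0 <- rho c) c0 ⊗ (T x ∙ h).
Proof. exact: cross_tensE. Qed.

Lemma incl_mulX t u :
  incl (mulX t u) = tens_mul (amul wC) (amul wH) (incl t) (incl u).
Proof.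
have bC := bilin_map (amul wC); have bH := bilin_map (amul wH).
have [l r] := bilin_tens_mul bC bH.
apply: (cross_ext (f := fun t => incl (mulX t u))
  (g := fun t => tens_mul _ _ (incl t) _)) t => [||c h].
- by lin.
- exact: (lin_comp (l _) (@lin_incl)).
apply: (cross_ext (f := fun u => incl (mulX _ u))
  (g := fun u => tens_mul _ _ _ (incl u))) u => [||b g].
- by lin.
- exact: (lin_comp (r _) (@lin_incl)).
rewrite mulX_cross !incl_cross tens_mul_tsum //; sw rho_mul.
apply: eq_tsum => x c0; apply: eq_tsum => y b0.
by rewrite tens_mulE // (eps_t_mul amulC) (amulACA amulC).
Qed.

(** By rho_comul_cross the coproduct of C ⊗ H projects the first factor; the
    second factor of such a coproduct is fixed by the projection, by
    comul_eps_t_snd and Δ(1) Δ(h) = Δ(h). *)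
Lemma incl_comulX t :
  \tsum_(u, v <- comulX t) incl u ⊗ incl v = tens_comul wH rho wC (incl t).
Proof.
apply: (cross_ext (f := fun t => \tsum_(u, v <- comulX t) _)
  (g := fun t => tens_comul wH rho wC (incl t))) t => [||c h].
- by lin.
- by rewrite /tens_comul; lin.
sw comulX_cross; symmetry.
rewrite /tens_comul incl_cross tsum_tsum; last by lin.
sw (tsum_tens (f := fun d g => \tsum_(c1, c2 <- comul wC d)
  \tsum_(x, c0 <- rho c2) \tsum_(h1, h2 <- comul wH g)
    (c1 ⊗ (x ∙ h1)) ⊗ (c0 ⊗ h2))).
sw (rho_comul_cross (F := fun p q r s => (p ⊗ q) ⊗ (r ⊗ s))).
swl (map_tsum (g := fun z => z ⊗ _)); symmetry.
swr incl_cross; swr incl_cross.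
swr tens_tsumr.
sw exch_tsum at 2; sw rho_coassoc at 1; sw exch_tsum at 2.
sw (comul_eps_t_snd (F := fun p q =>
  (\tsum_(y, d <- rho _) d ⊗ (T y ∙ (p ∙ _))) ⊗ (_ ⊗ (q ∙ _)))).
sw exch_tsum at 2.
have ac x y z : x ∙ y ∙ z = y ∙ (x ∙ z) by rewrite [x ∙ y]amulC amulA.
swr ac.
by sw (comul_1mul (F := fun p q =>
  (\tsum_(y, d <- rho _) d ⊗ (T y ∙ (_ ∙ p))) ⊗ (_ ⊗ q))).
Qed.

End Coaction.

Theorem mainTheorem13 (k : fieldType) (C H : lmodType k)
    (wC : weak_hopf C) (wH : weak_hopf H) (rho : {linear C -> tensor H C})
    (rho_bialg : comodule_bialgebra wH rho wC)
    (H_comm : forall g h : H, amul wH g h = amul wH h g) :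
  let X := cross_space wH rho in
  let cr : C -> H -> X := cross wH rho in
  let incl : X -> tensor C H := @cross_incl k H C wH rho in
  exists W : weak_hopf X,
    [/\ forall c b h g,
          amul W (cr c h) (cr b g) = cr (amul wC c b) (amul wH h g),
        aone W = cr (aone wC) (aone wH),
        forall c h,
          comul W (cr c h) =
          \tsum_(c1, c2 <- comul wC c)
          \tsum_(x, c0 <- rho c2) \tsum_(h1, h2 <- comul wH h)
            cr c1 (amul wH x h1) ⊗ cr c0 h2 &
        forall c h,
          counit W (cr c h) =
          \tsum_(x, c0 <- rho c) (counit wC c0 * counit wH (amul wH x h))]
    /\ (forall t u : X,
          incl (amul W t u) = tens_mul (amul wC) (amul wH) (incl t) (incl u))
    /\ (forall t : X,
          \tsum_(u, v <- comul W t) incl u ⊗ incl v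
          = tens_comul wH rho wC (incl t)).
Proof.
move=> X cr incl; exists (weak_hopfX rho_bialg H_comm); split; last first.
  by split=> [t u|t]; [apply: incl_mulX | apply: incl_comulX].
split=> *; [exact: mulX_cross | by [] | exact: comulX_crossE |].
exact: counitX_cross.
Qed.
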